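(* Assume all hypotheses of the following setting hold: $L>0$, $a,b,c>0$, $p\in L^1[0,L]$; $M,N>0$ with $N\le\frac{4M}{L^3}\sigma(\sqrt M L)$; $\alpha,\beta$ are a lower and an upper solution of (P) with $0\le\alpha\le\beta$ and $0\ge\alpha''\ge\beta''$ on $[0,L]$, $a+b\int_0^L\beta\le M$ and $c-b\min_{[0,L]}\beta''\le N$. Assume in addition $$a+b\int_0^L\alpha(x)dx+\frac{L^3}{4}c>\frac{L^3N}{4}+M-\frac{4}{L^2}.$$ Then (P) has a unique solution $\widetilde y$ in $[\alpha,\beta]:=\{u\in C^2[0,L]:\alpha\le u\le\beta,\ \alpha''\ge u''\ge\beta''\}$, the sequences $(\alpha_n)$ (started at $\alpha$) and $(\beta_n)$ (started at $\beta$) converge uniformly to $\widetilde y$, and for every initial function $y_0\in[\alpha,\beta]$ the sequence $(y_n)$ produced by the iteration converges uniformly to $\widetilde y$.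
   Context: (P) denotes the problem $w''''-(a+b\int_0^L w)w''+c\int_0^L w=p$ a.e. in $(0,L)$, $w(0)=w(L)=w''(0)=w''(L)=0$, with solutions in $W^{4,1}[0,L]$. $\sigma(t):=\dfrac{3t^3}{6t\cosh t+6t-12\sinh t-t^3}$ for $t>0$. A lower solution of (P) is $\alpha\in W^{4,1}[0,L]$ with $\alpha''''-(a+b\int_0^L\alpha)\alpha''+c\int_0^L\alpha\le p$ a.e. and $\alpha(0)=\alpha(L)=\alpha''(0)=\alpha''(L)=0$; an upper solution has the reversed inequality. The iteration: $y_n\in W^{4,1}[0,L]$ is the unique solution of $y_n''''-My_n''+N\int_0^L y_n=p+(a+b\int_0^L y_{n-1})y_{n-1}''-c\int_0^L y_{n-1}-My_{n-1}''+N\int_0^L y_{n-1}$ with $y_n(0)=y_n(L)=y_n''(0)=y_n''(L)=0$, $n\ge1$. *)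

(* Defs.v *)
From HB Require Import structures.
From mathcomp Require Import all_boot all_order all_algebra.
From mathcomp Require Import all_classical all_reals all_analysis.
Set Implicit Arguments. Unset Strict Implicit. Unset Printing Implicit Defensive.
Import Order.TTheory GRing.Theory Num.Theory.
Import numFieldNormedType.Exports.
Local Open Scope classical_set_scope.
Local Open Scope ring_scope.

Section Defs.
Variable R : realType.
Notation mu := (@lebesgue_measure R).

Definition int0 (x : R) (f : R -> R) : R := \int[mu]_(t in `[0, x]) f t.

Definition cosh (t : R) : R := (expR t + expR (- t)) / 2.
Definition sinh (t : R) : R := (expR t - expR (- t)) / 2.

Definition sigma (t : R) : R :=
  3 * t ^+ 3 / (6 * t * cosh t + 6 * t - 12 * sinh t - t ^+ 3).

Definition integrable_on (L : R) (f : R -> R) : Prop :=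
  mu.-integrable `[0, L] (EFin \o f).

(* "u1 is the antiderivative-derivative of u on [0,L]":
   u x = u 0 + \int_0^x u1 for x in [0,L], with u1 integrable on [0,L]
   (i.e. u is absolutely continuous with u' = u1 a.e.). *)
Definition prim_on (L : R) (u u1 : R -> R) : Prop :=
  integrable_on L u1 /\ forall x, 0 <= x <= L -> u x = u 0 + int0 x u1.

(* u in C^2[0,L] with first and second derivatives u1, u2 (one-sided at the
   endpoints): u2 continuous on [0,L], u' = u1, u1' = u2. *)
Definition C2_on (L : R) (u u1 u2 : R -> R) : Prop :=
  {within `[0, L], continuous u2} /\ prim_on L u1 u2 /\ prim_on L u u1.

(* w in W^{4,1}[0,L] with derivatives w1, w2, w3 and fourth derivative
   g in L^1[0,L] (w''' absolutely continuous, w'''' = g a.e.). *)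
Definition W41_on (L : R) (w w1 w2 w3 g : R -> R) : Prop :=
  C2_on L w w1 w2 /\ prim_on L w2 w3 /\ prim_on L w3 g.

Definition d2_on (L : R) (u u2 : R -> R) : Prop := exists u1, C2_on L u u1 u2.

Definition bc (L : R) (w w2 : R -> R) : Prop :=
  w 0 = 0 /\ w L = 0 /\ w2 0 = 0 /\ w2 L = 0.

Definition I (L : R) (w : R -> R) : R := int0 L w.

(* The operator of (P): with w2 = w'', g = w'''' *)
Definition Pop (L a b c : R) (w w2 g : R -> R) (x : R) : R :=
  g x - (a + b * I L w) * w2 x + c * I L w.

Definition Psol (L a b c : R) (p : R -> R) (w w2 : R -> R) : Prop :=
  exists w1 w3 g, W41_on L w w1 w2 w3 g /\ bc L w w2 /\
    {ae mu, forall x, 0 <= x <= L -> Pop L a b c w w2 g x = p x}.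

Definition lower_sol (L a b c : R) (p : R -> R) (w w2 : R -> R) : Prop :=
  exists w1 w3 g, W41_on L w w1 w2 w3 g /\ bc L w w2 /\
    {ae mu, forall x, 0 <= x <= L -> Pop L a b c w w2 g x <= p x}.

Definition upper_sol (L a b c : R) (p : R -> R) (w w2 : R -> R) : Prop :=
  exists w1 w3 g, W41_on L w w1 w2 w3 g /\ bc L w w2 /\
    {ae mu, forall x, 0 <= x <= L -> p x <= Pop L a b c w w2 g x}.

Definition in_order_interval (L : R) (al al2 be be2 u : R -> R) : Prop :=
  exists u2, d2_on L u u2 /\
    forall x, 0 <= x <= L ->
      al x <= u x <= be x /\ be2 x <= u2 x <= al2 x.

Definition iter_step (L a b c M N : R) (p : R -> R) (y y' : R -> R) : Prop :=
  exists y2, d2_on L y y2 /\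
  exists w1 w2 w3 g, W41_on L y' w1 w2 w3 g /\ bc L y' w2 /\
    {ae mu, forall x, 0 <= x <= L ->
       g x - M * w2 x + N * I L y' =
       p x + (a + b * I L y) * y2 x - c * I L y - M * y2 x + N * I L y}.

Definition iteration (L a b c M N : R) (p : R -> R) (y0 : R -> R)
  (y : nat -> R -> R) : Prop :=
  y 0%N = y0 /\ forall n, iter_step L a b c M N p (y n) (y n.+1).

Definition unif_cvg_on (L : R) (y : nat -> R -> R) (z : R -> R) : Prop :=
  forall e : R, 0 < e -> exists n0 : nat, forall n, (n0 <= n)%N ->
    forall x, 0 <= x <= L -> `|y n x - z x| < e.

End Defs.

(* Main.v *)
(* The nonlocal linear operator w'''' - M w'' + N ∫w obeys a maximum principle
   (nonnegative image and zero boundary values force w'' <= 0) exactly when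
   N <= 4M/L^3 sigma(sqrt M L). To see this, put u = -w'', m = sqrt M, and let K
   solve -K'' + m^2 K = 1 with zero boundary values. Then v = u + N (∫w) K solves a
   local problem, and the Wronskians of v with sinh (m x) and sinh (m (L - x))
   express v and bound ∫ v q, where q = x (L - x) / 2 and ∫w = ∫ u q.

   Existence is a scalar problem: for fixed J the equation
   w'''' - (a + bJ) w'' + cJ = p has a solution whose integral depends continuously
   on J, lies above ∫al for J = ∫al and below ∫be for J = ∫be, so some J is a fixed
   point. The solution lies in [al, be] by the maximum principle with M replaced by
   a + bJ, which is inherited because M - (a + bJ) < 4/L^2.

   The maximum principle makes the iteration preserve [al, be]; comparing with the
   function whose fourth derivative is 1, the last hypothesis makes it halve the sup
   distance of second derivatives. Uniqueness follows, since a solution is a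
   stationary sequence of the iteration. *)
Require Import Defs.
From HB Require Import structures.
From mathcomp Require Import all_boot all_order all_algebra.
From mathcomp Require Import all_classical all_reals all_analysis.
From mathcomp Require Import measurable_realfun.
From mathcomp Require Import ring lra.
Import Order.TTheory GRing.Theory Num.Theory.
Import numFieldNormedType.Exports.
Local Open Scope classical_set_scope.
Local Open Scope ring_scope.

Set Implicit Arguments.
Unset Strict Implicit.
Unset Printing Implicit Defensive.

(** * Geometric decay and repeated bisection *)

Lemma half_pow_small (R : realType) (C e : R) : 0 <= C -> 0 < e ->
  exists n0 : nat, forall n, (n0 <= n)%N -> C * 2^-1 ^+ n < e.
Proof.
move=> C0 e0; have C1 : 0 < C + 1 by lra.
have h : `|2^-1| < 1 :> R by rewrite ger0_norm ?invr_ge0//; lra.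
have /cvgrPdist_lt /(_ _ (divr_gt0 e0 C1)) [n0 _ hn] := cvg_expr h.
exists n0 => n /hn /=; rewrite sub0r normrN => /(le_lt_trans (ler_norm _)).
have k0 : 0 <= 2^-1 ^+ n :> R by apply: exprn_ge0; lra.
by rewrite ltr_pdivlMr//; set k := 2^-1 ^+ n in k0 *; lra.
Qed.

(* Halving the interval halves the constant [K]. *)
Lemma bisection_const (R : realType) (L K : R) (E A : R -> R) :
  0 <= K -> (forall x y, 0 <= x -> x <= y -> y <= L -> A x <= A y) ->
  (forall x y, 0 <= x -> x <= y -> y <= L ->
    `|E y - E x| <= K * (y - x) * (A y - A x)) ->
  forall x, 0 <= x <= L -> E x = E 0.
Proof.
move=> K0 Amon EA x /andP[x0 xL].
have step n : forall x y, 0 <= x -> x <= y -> y <= L ->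
    `|E y - E x| <= K * 2^-1 ^+ n * (y - x) * (A y - A x).
  elim: n => [|n IH] s t s0 st tL; first by rewrite expr0 mulr1; exact: EA.
  pose r := (s + t) / 2.
  have sr : s <= r by rewrite /r; lra.
  have rt : r <= t by rewrite /r; lra.
  have h1 := IH s r s0 sr (le_trans rt tL).
  have h2 := IH r t (le_trans s0 sr) rt tL.
  have -> : E t - E s = (E t - E r) + (E r - E s) by ring.
  apply: (le_trans (ler_normD _ _)); apply: (le_trans (lerD h2 h1)).
  rewrite exprS; set k := 2^-1 ^+ n; rewrite /r.
  by rewrite le_eqVlt; apply/orP; left; apply/eqP; field.
apply/eqP; rewrite -subr_eq0 -normr_le0; apply/ler_addgt0Pl => e e0; rewrite addr0.
have B0 : 0 <= K * x * (A x - A 0).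
  by rewrite mulr_ge0 ?mulr_ge0// subr_ge0; apply: Amon.
have [n /(_ n (leqnn n)) hn] := half_pow_small B0 e0.
apply: (le_trans (step n 0 x (lexx _) x0 xL)); rewrite subr0; apply/ltW.
by apply: le_lt_trans hn; rewrite le_eqVlt; apply/orP; left; apply/eqP; ring.
Qed.

(** * Integrals over [0, x] and almost everywhere statements *)

Section integral.
Context {R : realType}.
Notation mu := (@lebesgue_measure R).
Implicit Types (L : R) (f g F G : R -> R).

Lemma itv_cc_sub (L x : R) : x <= L -> `[0, x] `<=` `[0, L].
Proof.
by move=> xL t /=; rewrite !in_itv/= => /andP[-> /= tx]; exact: le_trans xL.
Qed.

Lemma itv_oc_sub (L x y : R) : 0 <= x -> y <= L -> `]x, y] `<=` `[0, L].
Proof.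
move=> x0 yL t /=; rewrite !in_itv/= => /andP[xt ty].
by rewrite (le_trans ty yL) (ltW (le_lt_trans x0 xt)).
Qed.

Lemma integrable_onS L f (D : set R) : measurable D -> D `<=` `[0, L] ->
  integrable_on L f -> mu.-integrable D (EFin \o f).
Proof. by move=> mD DL; apply: integrableS. Qed.

Lemma integrable_onD L f g : integrable_on L f -> integrable_on L g ->
  integrable_on L (fun x => f x + g x).
Proof. by move=> h1 h2; exact: (integrableD _ h1 h2). Qed.

Lemma integrable_onZ L k f : integrable_on L f ->
  integrable_on L (fun x => k * f x).
Proof. by move=> h; exact: (integrableZl _ _ h). Qed.

Lemma integrable_on_norm L f : integrable_on L f ->
  integrable_on L (fun x => `|f x|).
Proof. by move=> h; exact: (integrable_abse h). Qed.

Lemma integrable_on_cont L f : {within `[0, L], continuous f} ->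
  integrable_on L f.
Proof. by move=> h; apply: continuous_compact_integrable => //; exact: segment_compact. Qed.

Lemma cont_bounded L f : {within `[0, L], continuous f} ->
  exists2 C, 0 <= C & forall x, 0 <= x <= L -> `|f x| <= C.
Proof.
move=> cf; have [L0|L0] := leP 0 L; last first.
  by exists 0 => // x /andP[x0 xL]; have := le_trans x0 xL; rewrite leNgt L0.
have [s _ hs] := EVT_max L0 cf; have [i _ hi] := EVT_min L0 cf.
exists (`|f s| + `|f i|); first exact: addr_ge0.
move=> x xL; have xi : x \in `[0, L] by rewrite in_itv.
have := hs _ xi; have := hi _ xi; rewrite ler_norml => h1 h2.
have := ler_norm (f s); have := ler_norm (- f i); rewrite normrN.
have := normr_ge0 (f s); have := normr_ge0 (f i) => *.
by apply/andP; split; lra.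
Qed.

Lemma cont_bounded_set L f : {within `[0, L], continuous f} ->
  [bounded f x | x in `[0, L]].
Proof.
move=> /cont_bounded[C C0 hC]; exists C; split; first exact: num_real.
by move=> y Cy x /=; rewrite in_itv/= => xL; rewrite (le_trans (hC _ xL))// ltW.
Qed.

Lemma integrable_onM L f g : integrable_on L f ->
  {within `[0, L], continuous g} -> integrable_on L (fun x => f x * g x).
Proof.
move=> h cg; rewrite /integrable_on.
have -> : EFin \o (fun x => f x * g x) = ((EFin \o f) \* (EFin \o g))%E.
  by apply/funext => x /=; rewrite EFinM.
apply: integrableMl => //; last exact: cont_bounded_set.
exact: subspace_continuous_measurable_fun.
Qed.

Lemma int0B L f (x y : R) : 0 <= x -> x <= y -> y <= L -> integrable_on L f ->
  int0 y f - int0 x f = \int[mu]_(t in `]x, y]) f t.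
Proof.
move=> x0 xy yL h; rewrite /int0; apply: Rintegral_itvB; rewrite ?bnd_simp//.
exact: (integrable_onS (measurable_itv _) (@itv_cc_sub L y yL) h).
Qed.

Lemma int0D L f g x : x <= L -> integrable_on L f -> integrable_on L g ->
  int0 x (fun t => f t + g t) = int0 x f + int0 x g.
Proof.
move=> xL hf hg; rewrite /int0 RintegralD//;
  exact: (integrable_onS (measurable_itv _) (@itv_cc_sub L x xL)).
Qed.

Lemma int0Z L k f x : x <= L -> integrable_on L f ->
  int0 x (fun t => k * f t) = k * int0 x f.
Proof.
move=> xL hf; rewrite /int0 RintegralZl//.
exact: (integrable_onS (measurable_itv _) (@itv_cc_sub L x xL)).
Qed.

Lemma int0_eq (L : R) f g x : x <= L -> (forall t, 0 <= t <= L -> f t = g t) ->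
  int0 x f = int0 x g.
Proof.
move=> xL fg; apply: eq_Rintegral => t; rewrite inE/= in_itv/= => /andP[t0 tx].
by apply: fg; rewrite t0 (le_trans tx).
Qed.

Lemma int00 f : int0 0 f = 0.
Proof. by rewrite /int0 set_itv1 Rintegral_set1. Qed.

Lemma int0_cst (k x : R) : 0 <= x -> int0 x (fun=> k) = k * x.
Proof.
move=> x0; rewrite /int0 Rintegral_cst//= lebesgue_measure_itv/= lte_fin.
case: ifPn => [_|]; first by rewrite -EFinB/= subr0.
by rewrite -leNgt => x0'; have -> : x = 0 by apply/eqP; rewrite eq_le x0 x0'.
Qed.

Lemma integrable_on_cst L (k : R) : integrable_on L (fun=> k).
Proof. by apply: integrable_on_cont; move=> x; exact: cvg_cst. Qed.

Lemma ae_mono (P Q : R -> Prop) : (forall x, P x -> Q x) ->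
  {ae mu, forall x, P x} -> {ae mu, forall x, Q x}.
Proof. exact: (@filterS _ _ (ae_filter_ringOfSetsType mu)). Qed.

Lemma ae_mono2 (P Q S : R -> Prop) : (forall x, P x -> Q x -> S x) ->
  {ae mu, forall x, P x} -> {ae mu, forall x, Q x} -> {ae mu, forall x, S x}.
Proof. exact: (@filterS2 _ _ (ae_filter_ringOfSetsType mu)). Qed.

Lemma ae_all (P : R -> Prop) : (forall x, P x) -> {ae mu, forall x, P x}.
Proof. exact: (@filterE _ _ (ae_filter_ringOfSetsType mu)). Qed.

Lemma int0_ge0_ae (L : R) f (x y : R) : 0 <= x -> x <= y -> y <= L ->
  integrable_on L f -> {ae mu, forall t, 0 <= t <= L -> 0 <= f t} ->
  int0 x f <= int0 y f.
Proof.
move=> x0 xy yL hf f0; rewrite -subr_ge0 (int0B x0 xy yL hf).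
have mf : measurable_fun (`]x, y] : set R) (EFin \o f).
  apply: (measurable_int mu); exact: (integrable_onS (measurable_itv _) (@itv_oc_sub L x y x0 yL) hf).
(* The sign of [f] is known only almost everywhere; its absolute value has the same integral and is
   nonnegative at every point. *)
have e : (\int[mu]_(t in `]x, y]) (EFin \o f) t =
          \int[mu]_(t in `]x, y]) `|(EFin \o f) t|)%E.
  apply: ae_eq_integral => //; first exact: measurableT_comp.
  move: f0; apply: ae_mono => t h /= txy; rewrite ger0_norm//; apply: h.
  by have := @itv_oc_sub L x y x0 yL t txy; rewrite /= in_itv.
by rewrite /Rintegral e fine_ge0// integral_ge0.
Qed.

Lemma int0_norm_le (L : R) f g (x y : R) : 0 <= x -> x <= y -> y <= L ->
  integrable_on L f -> integrable_on L g ->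
  (forall t, x <= t <= y -> `|f t| <= g t) ->
  `|int0 y f - int0 x f| <= int0 y g - int0 x g.
Proof.
move=> x0 xy yL hf hg fg; rewrite !(int0B x0 xy yL)//.
have sD := @itv_oc_sub L x y x0 yL.
have h : `|\int[mu]_(t in `]x, y]) f t| <= \int[mu]_(t in `]x, y]) `|f t|.
  by apply: le_normr_Rintegral => //; exact: (integrable_onS (measurable_itv _) sD hf).
apply: (le_trans h).
apply: le_Rintegral => //.
- exact: (integrable_onS (measurable_itv _) sD (integrable_on_norm hf)).
- exact: (integrable_onS (measurable_itv _) sD hg).
- by move=> t /=; rewrite in_itv/= => /andP[xt ty]; apply: fg; rewrite ty ltW.
Qed.

Lemma int0_continuous L f : 0 <= L -> integrable_on L f ->
  {within `[0, L], continuous (fun x => int0 x f)}.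
Proof. by move=> L0 hf; exact: parameterized_integral_continuous. Qed.

End integral.

(** * Absolutely continuous functions: product rule, Wronskians, uniqueness of derivatives *)

Section primitive.
Context {R : realType}.
Notation mu := (@lebesgue_measure R).
Implicit Types (L : R) (f g F G : R -> R).

Lemma prim_ext L F f G g :
  (forall x, 0 <= x <= L -> F x = G x) -> (forall x, 0 <= x <= L -> f x = g x) ->
  0 <= L -> prim_on L F f -> prim_on L G g.
Proof.
move=> FG fg L0 [If Ff]; split.
  move: If; apply: eq_integrable => // x; rewrite inE/= in_itv/= => xL.
  by rewrite /= fg.
move=> x /andP[x0 xL]; rewrite -!FG ?x0 ?lexx// Ff ?x0//; congr (_ + _).
exact: (int0_eq xL).
Qed.

Lemma primE L F f x : prim_on L F f -> 0 <= x <= L -> F x = F 0 + int0 x f.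
Proof. by case=> _; apply. Qed.

Lemma primD L F f G g : prim_on L F f -> prim_on L G g ->
  prim_on L (fun x => F x + G x) (fun x => f x + g x).
Proof.
move=> [If Ff] [Ig Gg]; split; first exact: integrable_onD.
move=> x xL; rewrite Ff// Gg// (@int0D _ L)//; first by ring.
by case/andP: xL.
Qed.

Lemma primZ L k F f : prim_on L F f ->
  prim_on L (fun x => k * F x) (fun x => k * f x).
Proof.
move=> [If Ff]; split; first exact: integrable_onZ.
move=> x xL; rewrite Ff// (@int0Z _ L)//; first by ring.
by case/andP: xL.
Qed.

Lemma primB L F f G g : prim_on L F f -> prim_on L G g ->
  prim_on L (fun x => F x - G x) (fun x => f x - g x).
Proof.
move=> hF hG; have := primD hF (primZ (-1) hG).
under eq_fun do rewrite mulN1r.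
by under [X in prim_on _ _ X]eq_fun do rewrite mulN1r.
Qed.

Lemma prim_cst L k : prim_on L (fun=> k) (fun=> 0).
Proof.
split; first exact: integrable_on_cst.
by move=> x /andP[x0 _]; rewrite int0_cst// mul0r addr0.
Qed.

Lemma prim_id L : prim_on L id (fun=> 1).
Proof.
split; first exact: integrable_on_cst.
by move=> x /andP[x0 _]; rewrite int0_cst// mul1r add0r.
Qed.

Lemma prim_int0 L k f : integrable_on L f -> prim_on L (fun x => k + int0 x f) f.
Proof. by move=> h; split => // x _; rewrite int00 addr0. Qed.

Lemma prim_cont L F f : 0 <= L -> prim_on L F f -> {within `[0, L], continuous F}.
Proof.
move=> L0 [If Ff].
have c : {within `[0, L], continuous (fun x => F 0 + int0 x f)}.
  move=> x; apply: cvgD; first exact: cvg_cst.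
  exact: int0_continuous.
apply: (subspace_eq_continuous _ c) => x; rewrite inE/= in_itv/= => xL.
exact: esym (Ff _ xL).
Qed.

Lemma prim_nondecr L F f : prim_on L F f ->
  {ae mu, forall x, 0 <= x <= L -> 0 <= f x} ->
  forall x y, 0 <= x -> x <= y -> y <= L -> F x <= F y.
Proof.
move=> [If Ff] f0 x y x0 xy yL; have xL : 0 <= x <= L by rewrite x0 (le_trans xy yL).
have yL' : 0 <= y <= L by rewrite yL (le_trans x0 xy).
by rewrite (Ff x)// (Ff y)// lerD2l; exact: (int0_ge0_ae x0 xy yL).
Qed.

Lemma prim_nonincr L F f : prim_on L F f ->
  {ae mu, forall x, 0 <= x <= L -> f x <= 0} ->
  forall x y, 0 <= x -> x <= y -> y <= L -> F y <= F x.
Proof.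
move=> hF f0 x y x0 xy yL; have hN := primZ (-1) hF.
have : {ae mu, forall x, 0 <= x <= L -> 0 <= -1 * f x}.
  by move: f0; apply: ae_mono => t h /h; lra.
by move=> /(prim_nondecr hN) /(_ x y x0 xy yL); lra.
Qed.

(* Both factors are approximated by their endpoint values on [x, y]; the error
   is at most [2 C (y - x)] times the increment of the total variation of [F]. *)
Lemma primM L F f G g : 0 <= L -> prim_on L F f -> prim_on L G g ->
  {within `[0, L], continuous g} ->
  prim_on L (fun x => F x * G x) (fun x => f x * G x + F x * g x).
Proof.
move=> L0 hF hG cg.
have cF := prim_cont L0 hF; have cG := prim_cont L0 hG.
have [If Ff] := hF; have [Ig Gg] := hG.
have Ih : integrable_on L (fun x => f x * G x + F x * g x).
  apply: integrable_onD; first exact: integrable_onM.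
  under eq_fun do rewrite mulrC; exact: integrable_onM.
split => // x xL.
have [C C0 hC] := cont_bounded cg.
pose E t := F t * G t - int0 t (fun x => f x * G x + F x * g x).
pose A t := int0 t (fun s => `|f s|).
have In := integrable_on_norm If.
have Amon s t : 0 <= s -> s <= t -> t <= L -> A s <= A t.
  move=> s0 st tL; apply: (int0_ge0_ae s0 st tL) => //.
  by apply: ae_all => r _.
suff : E x = E 0.
  by rewrite /E int00 subr0 => /eqP; rewrite subr_eq => /eqP ->; rewrite addrC.
apply: (@bisection_const _ L (2 * C) E A) => //; first by rewrite mulr_ge0.
move=> s t s0 st tL.
have sL : 0 <= s <= L by rewrite s0 (le_trans st).
have tL' : 0 <= t <= L by rewrite tL (le_trans s0).
have Fd r : s <= r -> r <= t -> `|F s - F r| <= A t - A s.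
  move=> sr rt; have rL := le_trans rt tL.
  have := int0_norm_le s0 sr rL If In (fun z _ => lexx `|f z|).
  rewrite (Ff s)// (Ff r) ?rL ?(le_trans s0)// => h.
  rewrite -normrN; apply: (le_trans (le_trans _ h)).
    by rewrite le_eqVlt; apply/orP; left; apply/eqP; congr `|_|; ring.
  by rewrite lerD2r; apply: Amon => //; exact: le_trans sr.
have Gd r : s <= r -> r <= t -> `|G t - G r| <= C * (t - s).
  move=> sr rt; have r0 := le_trans s0 sr.
  have hb z : r <= z <= t -> `|g z| <= C.
    by move=> /andP[rz zt]; apply: hC; rewrite (le_trans r0 rz) (le_trans zt tL).
  have := int0_norm_le r0 rt tL Ig (integrable_on_cst L C) hb.
  rewrite !int0_cst ?(le_trans s0)// (Gg t)// (Gg r) ?r0 ?(le_trans rt)//.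
  have -> : G 0 + int0 t g - (G 0 + int0 r g) = int0 t g - int0 r g by ring.
  by move=> h; apply: (le_trans h); rewrite -mulrBr ler_wpM2l//; lra.
(* Since F t G t - F s G s = (F t - F s) G t + F s (G t - G s), the increment of [E] over [s, t] is
   the integral of [e]: the error made by freezing G at t and F at s. *)
pose e r := (f r * (G t - G r)) + (F s - F r) * g r.
have Ie : integrable_on L e.
  have cst_sub (k : R) H : {within `[0, L], continuous H} ->
      {within `[0, L], continuous (fun x => k - H x)}.
    by move=> cH z; apply: cvgB; [exact: cvg_cst|exact: cH].
  apply: integrable_onD; first by apply: integrable_onM => //; exact: cst_sub.
  under eq_fun do rewrite mulrC; apply: integrable_onM => //; exact: cst_sub.
have Ed : E t - E s = int0 t e - int0 s e.
  have tr r : 0 <= r <= L -> int0 r e =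
      int0 r f * G t + F s * int0 r g - int0 r (fun x => f x * G x + F x * g x).
    move=> /andP[r0 rL].
    have -> : int0 r e = int0 r (fun x => (G t * f x + F s * g x) +
                (-1) * (f x * G x + F x * g x)).
      by apply: (int0_eq rL) => z _; rewrite /e; ring.
    have I1 := integrable_onZ (G t) If; have I2 := integrable_onZ (F s) Ig.
    rewrite (int0D rL (integrable_onD I1 I2) (integrable_onZ (-1) Ih)).
    by rewrite (int0D rL I1 I2) !(int0Z _ rL)//; ring.
  rewrite !tr// /E.
  move: (Ff _ sL) (Ff _ tL') (Gg _ sL) (Gg _ tL') => e1 e2 e3 e4.
  rewrite e1 e2 e3 e4; ring.
rewrite Ed.
pose B r := C * (t - s) * `|f r| + (A t - A s) * C.
have IB : integrable_on L B.
  by apply: integrable_onD; [exact: integrable_onZ|exact: integrable_on_cst].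
have eB r : s <= r <= t -> `|e r| <= B r.
  move=> /andP[sr rt]; apply: (le_trans (ler_normD _ _)); rewrite !normrM.
  have rL : 0 <= r <= L by rewrite (le_trans s0 sr) (le_trans rt tL).
  apply: lerD; first by rewrite mulrC ler_wpM2r// Gd.
  by apply: ler_pM => //; [exact: Fd|exact: hC].
apply: (le_trans (int0_norm_le s0 st tL Ie IB eB)).
have hB r : 0 <= r <= L -> int0 r B = C * (t - s) * A r + (A t - A s) * C * r.
  move=> /andP[r0 rL].
  rewrite /B (int0D rL (integrable_onZ _ In) (integrable_on_cst L _)).
  by rewrite (int0Z _ rL In) int0_cst.
rewrite !hB// le_eqVlt; apply/orP; left; apply/eqP; ring.
Qed.

(** The cross terms v' s' cancel. Continuity is asked of [s2] alone, so that [v2] may be a fourth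
    derivative in L^1. *)
Lemma prim_wronskian L v v1 v2 s s1 s2 : 0 <= L ->
  prim_on L v v1 -> prim_on L v1 v2 -> prim_on L s s1 -> prim_on L s1 s2 ->
  {within `[0, L], continuous s2} ->
  prim_on L (fun x => v x * s1 x - v1 x * s x) (fun x => v x * s2 x - v2 x * s x).
Proof.
move=> L0 hv hv1 hs hs1 cs2.
have h1 := primM L0 hv hs1 cs2.
have h2 := primM L0 hv1 hs (prim_cont L0 hs1).
apply: prim_ext (primB h1 h2) => // x _; ring.
Qed.

Lemma prim_C1 L F f : 0 < L -> (forall x, is_derive x (1 : R) F (f x)) ->
  continuous f -> prim_on L F f.
Proof.
move=> L0 dF cf; have If : integrable_on L f.
  by apply: integrable_on_cont; exact: continuous_subspaceT.
split => // x /andP[x0 xL]; have [->|xn0] := eqVneq x 0; first by rewrite int00 addr0.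
have {}x0 : 0 < x by rewrite lt_neqAle eq_sym xn0.
have cF y : {for y, continuous F}.
  by apply: differentiable_continuous; apply/derivable1_diffP; case: (dF y).
rewrite /int0 /Rintegral (@continuous_FTC2 _ f F 0 x)//=; first by ring.
- exact: continuous_subspaceT.
- split => [y _| |].
  + by case: (dF y).
  + by apply: cvg_at_right_filter; exact: cF.
  + by apply: cvg_at_left_filter; exact: cF.
- by move=> y _; rewrite derive1E; case: (dF y).
Qed.

(** By continuity a negative value of [f] persists on an interval; the integral of [f] over it would
    be negative, yet it is an increment of the constant [F]. *)
Lemma prim_cont_ge0 L F f : 0 < L -> prim_on L F f ->
  {within `[0, L], continuous f} -> (forall x, 0 <= x <= L -> F x = F 0) ->
  forall x, 0 <= x <= L -> 0 <= f x.
Proof.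
move=> L0 [If Ff] cf FE x xL; rewrite leNgt; apply/negP => fx0.
have [d d0 hd] : exists2 d : R, 0 < d &
    forall y : R, 0 <= y <= L -> `|x - y| < d -> f y < f x / 2.
  move/subspace_continuousP : cf => /(_ x); rewrite /= in_itv/= => /(_ xL).
  have e0 : 0 < - f x / 2 by lra.
  move=> /cvgrPdist_lt /(_ _ e0) /nbhs_ballP[d /= d0 hd].
  exists d => // y yL xy; have := hd y xy; rewrite /= in_itv/= => /(_ yL).
  by rewrite /from_subspace ltr_norml => /andP[h1 h2]; lra.
have {}Ff y : 0 <= y <= L -> int0 y f = 0.
  by move=> yL; have := Ff _ yL; rewrite FE// => h; lra.
(* Cutting at 0 and L keeps the interval inside [0, L] and nondegenerate even when x is an
   endpoint. *)
pose s := Num.max 0 (x - d / 2); pose t := Num.min L (x + d / 2).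
have [x0 xL'] := andP xL.
have s0 : 0 <= s by rewrite /s le_max lexx.
have tL : t <= L by rewrite /t ge_min lexx.
have st : s < t.
  rewrite /s /t gt_max !lt_min L0 /=; apply/andP; split; first by lra.
  by apply/andP; split; lra.
have ss : x - d / 2 <= s by rewrite /s le_max lexx orbT.
have tt : t <= x + d / 2 by rewrite /t ge_min lexx orbT.
have sx : s <= x by rewrite /s ge_max x0; lra.
have xt : x <= t by rewrite /t le_min xL'; lra.
have sL : 0 <= s <= L by rewrite s0 (le_trans sx).
have tL' : 0 <= t <= L by rewrite tL (le_trans x0).
pose g z := f z - f x / 2.
have Ig : integrable_on L g by exact: (integrable_onD If (integrable_on_cst L _)).
(* On [s, t] the zero function is dominated by f x / 2 - f z. As [f] integrates to 0 there, this
   yields 0 <= (f x / 2) (t - s), a contradiction. *)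
have h : `|int0 t (fun=> 0 : R) - int0 s (fun=> 0 : R)| <=
    int0 t (fun z => -1 * (f z - f x / 2)) - int0 s (fun z => -1 * (f z - f x / 2)).
  apply: (int0_norm_le s0 (ltW st) tL (integrable_on_cst L _)).
    exact: integrable_onZ.
  move=> z /andP[sz zt]; rewrite normr0.
  have zL : 0 <= z <= L by rewrite (le_trans s0) ?(le_trans zt).
  have : f z < f x / 2 by apply: hd => //; rewrite ltr_norml; apply/andP; split; lra.
  by lra.
have e z : 0 <= z <= L -> int0 z (fun z => -1 * (f z - f x / 2)) = f x / 2 * z.
  move=> /[dup] zL /andP[z0 zL']; rewrite (int0Z _ zL' Ig).
  by rewrite (int0D zL' If (integrable_on_cst L _)) int0_cst// Ff//; lra.
move: h; rewrite !e// => /(le_trans (normr_ge0 _)).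
by rewrite -mulrBr pmulr_lge0 ?subr_gt0//; lra.
Qed.

(** The constant F - F is a primitive of both f - g and g - f, so neither takes a negative value. *)
Lemma prim_uniq L F f g : 0 < L -> prim_on L F f -> prim_on L F g ->
  {within `[0, L], continuous f} -> {within `[0, L], continuous g} ->
  forall x, 0 <= x <= L -> f x = g x.
Proof.
move=> L0 hf hg cf cg x xL.
have h0 H : forall y, 0 <= y <= L -> H y - H y = H 0 - H 0 :> R.
  by move=> y _; rewrite !subrr.
have c1 : {within `[0, L], continuous (fun x => f x - g x)}.
  by move=> z; apply: cvgB; [exact: cf|exact: cg].
have c2 : {within `[0, L], continuous (fun x => g x - f x)}.
  by move=> z; apply: cvgB; [exact: cg|exact: cf].
have := prim_cont_ge0 L0 (primB hf hg) c1 (h0 F) xL.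
have := prim_cont_ge0 L0 (primB hg hf) c2 (h0 F) xL.
by move=> h1 h2; lra.
Qed.

End primitive.

(** * Hyperbolic functions with polynomial corrections *)

Section hyperbolic.
Context {R : realType}.
Implicit Types (m L x y : R).

Lemma cosh2B_sinh2 x : cosh x ^+ 2 - sinh x ^+ 2 = 1.
Proof.
by rewrite -(expRxMexpNx_1 x) /cosh /sinh; field.
Qed.

Lemma sinhB x y : sinh (x - y) = sinh x * cosh y - cosh x * sinh y.
Proof.
by rewrite /cosh /sinh opprB !expRD; field.
Qed.

Lemma coshB x y : cosh (x - y) = cosh x * cosh y - sinh x * sinh y.
Proof.
by rewrite /cosh /sinh opprB !expRD; field.
Qed.

Lemma sinh0 : sinh 0 = 0 :> R.
Proof. by rewrite /sinh oppr0 subrr mul0r. Qed.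

Lemma cosh0 : cosh 0 = 1 :> R.
Proof. by rewrite /cosh oppr0 expR0; field. Qed.

Lemma sinh_ge0 x : 0 <= x -> 0 <= sinh x.
Proof.
by move=> x0; rewrite /sinh divr_ge0// subr_ge0 ler_expR; lra.
Qed.

Lemma sinh_gt0 x : 0 < x -> 0 < sinh x.
Proof.
by move=> x0; rewrite /sinh divr_gt0// subr_gt0 ltr_expR; lra.
Qed.

Lemma cosh_ge1 x : 1 <= cosh x.
Proof.
have h := expRxMexpNx_1 x; rewrite /cosh.
have := sqr_ge0 (expR x - expR (- x)).
have := expR_gt0 x; have := expR_gt0 (- x) => h1 h2 h3.
nra.
Qed.

(* Closed under differentiation; every explicit auxiliary function is an instance. *)
Definition hyp m (A B c0 c1 c2 c3 c4 x : R) : R :=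
  A * sinh (m * x) + B * cosh (m * x) +
  (c0 + c1 * x + c2 * x ^+ 2 + c3 * x ^+ 3 + c4 * x ^+ 4).

Lemma is_derive_hyp m A B c0 c1 c2 c3 c4 x :
  is_derive x (1 : R) (hyp m A B c0 c1 c2 c3 c4)
    (hyp m (B * m) (A * m) c1 (2 * c2) (3 * c3) (4 * c4) 0 x).
Proof.
have e k : is_derive x (1 : R) (fun z => expR (k * z)) (k * expR (k * x)).
  have d : is_derive x (1 : R) (fun z => k * z) k.
    by apply: is_derive_eq; rewrite /GRing.scale/=; ring.
  have := @is_derive1_comp _ _ _ _ _ _ (is_derive_expR (k * x)) d.
  by rewrite mulrC.
have ep := e m; have en := e (- m).
have -> : hyp m A B c0 c1 c2 c3 c4 = fun z =>
   ((A + B) / 2) * expR (m * z) + ((B - A) / 2) * expR (- m * z) +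
   (c0 + c1 * z + c2 * z ^+ 2 + c3 * z ^+ 3 + c4 * z ^+ 4).
  by apply/funext => z; rewrite /hyp /sinh /cosh !mulNr; field.
apply: is_derive_eq.
by rewrite /hyp /sinh /cosh /GRing.scale /= !mulNr; field.
Qed.

Lemma prim_hyp m A B c0 c1 c2 c3 c4 L : 0 < L ->
  prim_on L (hyp m A B c0 c1 c2 c3 c4)
    (hyp m (B * m) (A * m) c1 (2 * c2) (3 * c3) (4 * c4) 0).
Proof.
move=> L0; apply: prim_C1 => // [x|x]; first exact: is_derive_hyp.
apply: differentiable_continuous; apply/derivable1_diffP.
by case: (is_derive_hyp m (B * m) (A * m) c1 (2 * c2) (3 * c3) (4 * c4) 0 x).
Qed.

Lemma hyp_cont m A B c0 c1 c2 c3 c4 L : 0 < L ->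
  {within `[0, L], continuous (hyp m A B c0 c1 c2 c3 c4)}.
Proof. by move=> L0; exact: (prim_cont (ltW L0) (prim_hyp _ _ _ _ _ _ _ _ L0)). Qed.

End hyperbolic.

Arguments prim_hyp {R m A B c0 c1 c2 c3 c4 L}.
Arguments hyp_cont {R m A B c0 c1 c2 c3 c4 L}.

(** * Maximum principle for the local operator m^2 v - v'' *)

Section maximum_principle.
Context {R : realType}.
Notation mu := (@lebesgue_measure R).

(** The Wronskian of v and the test function [f], less the integral of v r, has derivative (m^2 v -
    v'') f. Comparing with an endpoint bounds v itself when r = 0, and the integral of v r
    otherwise. *)
Lemma green_monotone (L m : R) (v v1 v2 f f1 f2 r : R -> R) : 0 < L ->
  prim_on L v v1 -> prim_on L v1 v2 -> prim_on L f f1 -> prim_on L f1 f2 ->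
  {within `[0, L], continuous f2} -> {within `[0, L], continuous r} ->
  (forall x, 0 <= x <= L -> f2 x = m ^+ 2 * f x + r x) ->
  (forall x, 0 <= x <= L -> 0 <= f x) ->
  {ae mu, forall x, 0 <= x <= L -> 0 <= m ^+ 2 * v x - v2 x} ->
  forall x y, 0 <= x -> x <= y -> y <= L ->
    v x * f1 x - v1 x * f x - int0 x (fun z => v z * r z) <=
    v y * f1 y - v1 y * f y - int0 y (fun z => v z * r z).
Proof.
move=> L0 hv hv1 hf hf1 cf2 cr f2E f0 v0.
have Ivr : integrable_on L (fun z => v z * r z).
  by apply: integrable_onM => //; exact: integrable_on_cont (prim_cont (ltW L0) hv).
have h := primB (prim_wronskian (ltW L0) hv hv1 hf hf1 cf2) (prim_int0 0 Ivr).
move=> x y x0 xy yL.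
have := prim_nondecr h _ x0 xy yL; rewrite !add0r; apply.
move: v0; apply: ae_mono => z hz zL.
have -> : v z * f2 z - v2 z * f z - v z * r z = (m ^+ 2 * v z - v2 z) * f z.
  by rewrite f2E//; ring.
by rewrite mulr_ge0 ?hz ?f0.
Qed.

Lemma sinh_mul_ge0 (m x : R) : 0 <= m -> 0 <= x -> 0 <= sinh (m * x).
Proof. by move=> m0 x0; rewrite sinh_ge0// mulr_ge0. Qed.

(* [X] and [Y] are the integrals of [m^2 v - v''] against [sinh (m s)] on [0, x]
   and against [sinh (m (L - s))] on [x, L]. *)
Lemma green_decomposition (L m : R) (v v1 v2 : R -> R) : 0 < L -> 0 < m ->
  prim_on L v v1 -> prim_on L v1 v2 -> 0 <= v 0 -> 0 <= v L ->
  {ae mu, forall x, 0 <= x <= L -> 0 <= m ^+ 2 * v x - v2 x} ->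
  forall x, 0 <= x <= L ->
  let X := v x * (m * cosh (m * x)) - v1 x * sinh (m * x) in
  let Y := v1 x * sinh (m * L - m * x) + v x * (m * cosh (m * L - m * x)) in
  [/\ 0 <= X, 0 <= Y, 0 <= v x &
      sinh (m * L - m * x) * X + sinh (m * x) * Y = m * sinh (m * L) * v x].
Proof.
move=> L0 m0 hv hv1 v0 vL ae x /[dup] xL /andP[x0 xL'] X Y.
have kerint (y : R) : y <= L -> 0 <= y -> int0 y (fun z => v z * 0) = 0.
  move=> yL y0; rewrite (_ : (fun _ => _) = (fun=> 0)) ?int0_cst ?mul0r//.
  by apply/funext => z; rewrite mulr0.
have c0 : {within `[0, L], continuous (fun=> 0 : R)} by move=> z; exact: cvg_cst.
have X0 : 0 <= X.
  (* Test function sinh (m x), which vanishes at 0. *)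
  have := @green_monotone L m v v1 v2 (hyp m 1 0 0 0 0 0 0) _ _ (fun=> 0) L0 hv hv1
    (prim_hyp L0) (prim_hyp L0)
    (hyp_cont L0) c0 _ _ ae 0 x (lexx 0) x0 xL'.
  rewrite !kerint//; last exact: ltW.
  rewrite /hyp !mulr0 sinh0 cosh0 => h; apply: (le_trans _ (le_trans (h _ _) _)).
  - by have := mulr_ge0 v0 (ltW m0); lra.
  - by move=> z _; ring.
  - by move=> z /andP[z0 _]; have := sinh_mul_ge0 (ltW m0) z0; lra.
  - by rewrite /X; lra.
have Y0 : 0 <= Y.
  (* Test function sinh (m (L - x)) in expanded form, which vanishes at L. *)
  have := @green_monotone L m v v1 v2
    (hyp m (- cosh (m * L)) (sinh (m * L)) 0 0 0 0 0) _ _ (fun=> 0) L0 hv hv1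
    (prim_hyp L0) (prim_hyp L0)
    (hyp_cont L0) c0 _ _ ae x L x0 xL' (lexx L).
  rewrite !kerint//; last exact: ltW.
  rewrite /hyp => h; have {}h := h _ _.
  have {}h : v x * (sinh (m * L) * m * sinh (m * x) + - cosh (m * L) * m * cosh (m * x))
     - v1 x * sinh (m * L - m * x) <= - m * v L * (cosh (m * L) ^+ 2 - sinh (m * L) ^+ 2).
    rewrite sinhB; apply: (le_trans (le_trans _ (h _ _))).
    - by lra.
    - by move=> z _; ring.
    - move=> z /andP[z0 zL].
      have : 0 <= sinh (m * L - m * z).
        by rewrite sinh_ge0// -mulrBr mulr_ge0 ?subr_ge0// ltW.
      by rewrite sinhB; lra.
    - by rewrite le_eqVlt; apply/orP; left; apply/eqP; ring.
  move: h; rewrite cosh2B_sinh2 /Y coshB => h.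
  have := mulr_ge0 (ltW m0) vL; lra.
(* The weights eliminate [v1]; a positive multiple of [v x] remains, which gives the sign of
   [v x]. *)
have e : sinh (m * L - m * x) * X + sinh (m * x) * Y = m * sinh (m * L) * v x.
  rewrite /X /Y coshB sinhB.
  rewrite -[RHS]mulr1 -(cosh2B_sinh2 (m * x)); ring.
have s0 : 0 < m * sinh (m * L) by rewrite mulr_gt0// sinh_gt0// mulr_gt0.
split => //; rewrite -(pmulr_rge0 _ s0) -e addr_ge0// mulr_ge0//.
- by rewrite sinh_ge0// -mulrBr mulr_ge0 ?subr_ge0// ltW.
- exact: (sinh_mul_ge0 (ltW m0)).
Qed.

Lemma max_principle (L m : R) (v v1 v2 : R -> R) : 0 < L -> 0 < m ->
  prim_on L v v1 -> prim_on L v1 v2 -> 0 <= v 0 -> 0 <= v L ->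
  {ae mu, forall x, 0 <= x <= L -> 0 <= m ^+ 2 * v x - v2 x} ->
  forall x, 0 <= x <= L -> 0 <= v x.
Proof.
by move=> L0 m0 hv hv1 v0 vL h x xL; case: (green_decomposition L0 m0 hv hv1 v0 vL h xL).
Qed.

Lemma convex_ge0 (L : R) (f f1 f2 : R -> R) : 0 < L ->
  prim_on L f f1 -> prim_on L f1 f2 -> f 0 = 0 -> f1 0 = 0 ->
  (forall x, 0 <= x <= L -> 0 <= f2 x) -> forall x, 0 <= x <= L -> 0 <= f x.
Proof.
move=> L0 hf hf1 f0 f10 f2_ge0 x /andP[x0 xL].
rewrite -f0; apply: (prim_nondecr hf) => //.
apply: ae_all => z /andP[z0 zL]; rewrite -f10; apply: (prim_nondecr hf1) => //.
by apply: ae_all.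
Qed.

End maximum_principle.

(** * Maximum principle for the nonlocal operator *)

Section nonlocal_maximum_principle.
Context {R : realType}.
Notation mu := (@lebesgue_measure R).

Lemma hyp_parabola (m L x : R) :
  hyp m 0 0 0 (L / 2) (- (1 / 2)) 0 0 x = x * (L - x) / 2.
Proof. by rewrite /hyp; field. Qed.

(** Green's formula for [w] and q = x (L - x) / 2: q'' = -1, and both functions vanish at 0 and
    L. *)
Lemma moment_by_parts (L : R) (w w1 w2 : R -> R) : 0 < L ->
  prim_on L w w1 -> prim_on L w1 w2 -> {within `[0, L], continuous w2} ->
  w 0 = 0 -> w L = 0 ->
  int0 L w = int0 L (fun x => - w2 x * (x * (L - x) / 2)).
Proof.
move=> L0 hw hw1 cw2 w0 wL.
have h := prim_wronskian (ltW L0) (@prim_hyp _ 1 0 0 0 (L / 2) (- (1 / 2)) 0 0 _ L0)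
  (prim_hyp L0) hw hw1 cw2.
have Iw := integrable_on_cont (prim_cont (ltW L0) hw).
have Iq : integrable_on L (fun x => - w2 x * (x * (L - x) / 2)).
  have := integrable_onZ (-1) (integrable_onM (integrable_on_cont cw2)
            (@hyp_cont _ 1 0 0 0 (L / 2) (- (1 / 2)) 0 0 _ L0)).
  by congr (integrable_on _ _); apply/funext => x; rewrite hyp_parabola; ring.
have LL : 0 <= L <= L by rewrite lexx ltW.
have := primE h LL; rewrite w0 wL /hyp.
rewrite (_ : int0 L _ = int0 L (fun x => w x + -1 * (- w2 x * (x * (L - x) / 2)))).
  rewrite (int0D (lexx L) Iw (integrable_onZ _ Iq)) (int0Z _ (lexx L) Iq) => e.
  by lra.
by apply: (int0_eq (lexx L)) => x _; field.
Qed.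

(** The bound on [N] is N <= 4 M / L^3 sigma (m L) with M = m^2 and the denominator cleared. With J
    = ∫w, v = -w'' + N J K and k = ∫ K q one has ∫ v q = J (1 + N k). Hence w'' <= 0 follows from K
    ∫ v q <= C v and N C <= 1 + N k. For the constant C = kap T s / m^2 found below, the last
    inequality is exactly the bound on [N]. *)
Lemma nonlocal_max_principle_aux (L m N : R) (w w1 w2 w3 g : R -> R) :
  0 < L -> 0 < m -> 0 < N ->
  N * (6 * (m * L) * cosh (m * L) + 6 * (m * L) - 12 * sinh (m * L) - (m * L) ^+ 3)
    <= 12 * m ^+ 5 ->
  W41_on L w w1 w2 w3 g -> bc L w w2 ->
  {ae mu, forall x, 0 <= x <= L -> 0 <= g x - m ^+ 2 * w2 x + N * I L w} ->
  forall x, 0 <= x <= L -> w2 x <= 0.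
Proof.
move=> L0 m0 N0 ND [[cw2 [hw1 hw]] [hw2 hw3]] [w0 [wL [w20 w2L]]] hae x xL.
have [x0 xL'] := andP xL.
have L0' := ltW L0.
have LL : 0 <= L <= L by rewrite lexx ltW.
have OL : 0 <= (0 : R) <= L by rewrite lexx ltW.
have mn0 : m != 0 by rewrite gt_eqF.
have m2 : 0 < m ^+ 2 by rewrite exprn_gt0.
pose s := sinh (m * L); pose c := cosh (m * L).
have s0 : 0 < s by rewrite sinh_gt0// mulr_gt0.
have c1 : 1 <= c by exact: cosh_ge1.
have cs : c ^+ 2 - s ^+ 2 = 1 by exact: cosh2B_sinh2.
(* [T] is tanh (m L / 2); [Ts] and [Tc] are its half-angle identities. *)
pose T := (c - 1) / s.
have T0 : 0 <= T by rewrite divr_ge0 ?subr_ge0// ltW.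
have Ts : T * s = c - 1 by rewrite /T; field; rewrite gt_eqF.
have Tc : T * (c + 1) = s.
  apply: (mulIf (lt0r_neq0 s0)); rewrite mulrAC Ts -[RHS]expr2.
  by transitivity (c ^+ 2 - 1); [ring|lra].
pose q z := z * (L - z) / 2.
have q0 z : 0 <= z <= L -> 0 <= q z.
  by move=> /andP[z0 zL]; rewrite /q divr_ge0// mulr_ge0// subr_ge0.
have cq : {within `[0, L], continuous q}.
  have -> : q = hyp m 0 0 0 (L / 2) (- (1 / 2)) 0 0.
    by apply/funext => z; rewrite hyp_parabola.
  exact: hyp_cont.
(* -K'' + m^2 K = 1 with K 0 = K L = 0. *)
pose K := hyp m (T / m ^+ 2) (- (1 / m ^+ 2)) (1 / m ^+ 2) 0 0 0 0.
pose K1 := hyp m (- (1 / m ^+ 2) * m) (T / m ^+ 2 * m) 0 (2 * 0) (3 * 0) (4 * 0) 0.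
pose K2 := hyp m (T / m ^+ 2 * m * m) (- (1 / m ^+ 2) * m * m)
  (2 * 0) (2 * (3 * 0)) (3 * (4 * 0)) (4 * 0) 0.
have KE z : K z = (1 - cosh (m * z) + T * sinh (m * z)) / m ^+ 2.
  by rewrite /K /hyp; field.
have K2E z : K2 z = m ^+ 2 * K z - 1 by rewrite KE /K2 /hyp; field.
have hK : prim_on L K K1 by exact: prim_hyp.
have hK1 : prim_on L K1 K2 by exact: prim_hyp.
have KO : K 0 = 0 by rewrite KE mulr0 sinh0 cosh0; field.
have KL : K L = 0 by rewrite KE -/s -/c Ts; field.
have K0 z : 0 <= z <= L -> 0 <= K z.
  apply: (max_principle L0 m0 hK hK1); rewrite ?KO ?KL//.
  by apply: ae_all => y _; rewrite K2E; lra.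
have mLz z : z <= L -> 0 <= m * L - m * z.
  by move=> zL; rewrite -mulrBr mulr_ge0 ?subr_ge0// ltW.
(* [KS] and [KS'] are mirror images under x -> L - x; each drops a term (cosh - 1) / m^2. *)
have KS : K x <= T / m ^+ 2 * sinh (m * x).
  rewrite KE -subr_ge0.
  have -> : T / m ^+ 2 * sinh (m * x) - (1 - cosh (m * x) + T * sinh (m * x)) / m ^+ 2 =
     (cosh (m * x) - 1) / m ^+ 2 by field.
  by rewrite divr_ge0 ?subr_ge0 ?cosh_ge1// ltW.
have KS' : K x <= T / m ^+ 2 * sinh (m * L - m * x).
  rewrite KE -subr_ge0 sinhB -/s -/c.
  have -> : T / m ^+ 2 * (s * cosh (m * x) - c * sinh (m * x)) -
     (1 - cosh (m * x) + T * sinh (m * x)) / m ^+ 2 =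
     ((T * s + 1) * cosh (m * x) - T * (c + 1) * sinh (m * x) - 1) / m ^+ 2 by field.
  rewrite Ts Tc subrK -coshB.
  by rewrite divr_ge0 ?subr_ge0 ?cosh_ge1// ltW.
pose kap := (L / 2 - T / m) / m ^+ 2.
(* The product kap s is the integral of q(z) sinh (m z) over [0, L], as the Wronskian of q and sinh
   (m z) shows. *)
have kap0 : 0 <= kap.
  have hq := prim_wronskian L0' (@prim_hyp _ m 0 0 0 (L / 2) (- (1 / 2)) 0 0 _ L0)
    (prim_hyp L0) (@prim_hyp _ m 1 0 0 0 0 0 0 _ L0) (prim_hyp L0) (hyp_cont L0).
  have h := primB hq (@prim_hyp _ m 0 (1 / m) 0 0 0 0 0 _ L0).
  have := prim_nondecr h _ (lexx 0) L0' (lexx L).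
  rewrite /hyp !mulr0 sinh0 cosh0 -/s -/c => /(_ _) h1.
  have {}h1 : 0 <= L / 2 * s - (c - 1) / m.
    apply: (le_trans _ (le_trans (lerD (h1 _) (lexx (1 / m))) _)).
    - by rewrite le_eqVlt; apply/orP; left; apply/eqP; field.
    - apply: ae_all => z zL.
      have := mulr_ge0 (q0 z zL) (sinh_mul_ge0 (ltW m0) (proj1 (andP zL))).
      move=> /(mulr_ge0 (ltW m2)) hh; apply: (le_trans hh).
      by rewrite /q le_eqVlt; apply/orP; left; apply/eqP; field.
    - by rewrite le_eqVlt; apply/orP; left; apply/eqP; field.
  have e : kap = (L / 2 * s - (c - 1) / m) / (s * m ^+ 2).
    by rewrite /kap -Ts; field; rewrite mn0 gt_eqF.
  by rewrite e divr_ge0// mulr_ge0 ?ltW.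
(* [Z := (q - K) / m^2] solves -Z'' + m^2 Z = q, and kap = Z'(0); [f] and [f'] are
   the differences of Z with the homogeneous solutions having the same slope at 0,
   respectively L. *)
pose A := kap / m + T / m ^+ 4.
pose f := hyp m A (- (1 / m ^+ 4)) (1 / m ^+ 4) (- (L / (2 * m ^+ 2)))
  (1 / (2 * m ^+ 2)) 0 0.
have fE z : f z = kap / m * sinh (m * z) - (q z - K z) / m ^+ 2.
  by rewrite /f /hyp /A KE /q; field.
have f0 z : 0 <= z <= L -> 0 <= f z.
  apply: (convex_ge0 L0 (prim_hyp L0) (prim_hyp L0)).
  - by rewrite /hyp mulr0 sinh0 cosh0; field.
  - by rewrite /hyp mulr0 sinh0 cosh0 /A /kap; field.
  move=> y yL.
  have := K0 y yL; have := sinh_mul_ge0 (ltW m0) (proj1 (andP yL)).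
  move=> /(mulr_ge0 (mulr_ge0 kap0 (ltW m0))) h1 h2.
  apply: (le_trans (addr_ge0 h1 h2)); rewrite KE /hyp /A.
  by rewrite le_eqVlt; apply/orP; left; apply/eqP; field.
pose f' := hyp m (- (kap * c / m) + T / m ^+ 4) (kap * s / m - 1 / m ^+ 4) (1 / m ^+ 4)
  (- (L / (2 * m ^+ 2))) (1 / (2 * m ^+ 2)) 0 0.
have f'E z : f' z = kap / m * sinh (m * L - m * z) - (q z - K z) / m ^+ 2.
  by rewrite /f' /hyp KE /q sinhB -/s -/c; field.
have f'L : f' L = 0 by rewrite f'E KL subrr sinh0 /q; field.
have f'0 z : 0 <= z <= L -> 0 <= f' z.
  move=> /andP[z0 zL].
  have -> : f' z = f (L - z); last by apply: f0; apply/andP; split; lra.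
  rewrite f'E fE mulrBr; congr (_ - _ / _).
  congr (_ - _); first by rewrite /q; field.
  rewrite !KE mulrBr sinhB coshB -/s -/c; congr (_ / _).
  transitivity (1 - (c - T * s) * cosh (m * z) + (s - T * c) * sinh (m * z)); last by ring.
  by rewrite Ts -Tc; ring.
pose J := I L w.
pose v z := - w2 z + N * J * K z.
pose v1 z := - w3 z + N * J * K1 z.
pose v2 z := - g z + N * J * K2 z.
have hv : prim_on L v v1.
  by apply: prim_ext (primD (primZ (-1) hw2) (primZ (N * J) hK)) => // z _;
    rewrite /v /v1; ring.
have hv1 : prim_on L v1 v2.
  by apply: prim_ext (primD (primZ (-1) hw3) (primZ (N * J) hK1)) => // z _;
    rewrite /v1 /v2; ring.
have vO : v 0 = 0 by rewrite /v w20 KO; ring.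
have vL : v L = 0 by rewrite /v w2L KL; ring.
have vae : {ae mu, forall z, 0 <= z <= L -> 0 <= m ^+ 2 * v z - v2 z}.
  move: hae; apply: ae_mono => z hz zL; have := hz zL.
  by rewrite /v /v2 K2E -/J; lra.
have vO' : 0 <= v 0 by rewrite vO.
have vL' : 0 <= v L by rewrite vL.
have := green_decomposition L0 m0 hv hv1 vO' vL' vae xL.
set X := v x * _ - _; set Y := v1 x * _ + _ => -[X0 Y0 v0 XY].
pose f1 := hyp m (- (1 / m ^+ 4) * m) (A * m) (- (L / (2 * m ^+ 2)))
  (2 * (1 / (2 * m ^+ 2))) (3 * 0) (4 * 0) 0.
pose f'1 := hyp m ((kap * s / m - 1 / m ^+ 4) * m) ((- (kap * c / m) + T / m ^+ 4) * m)
  (- (L / (2 * m ^+ 2))) (2 * (1 / (2 * m ^+ 2))) (3 * 0) (4 * 0) 0.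
(* [f] solves f'' = m^2 f + q and vanishes at 0, so it controls the integral of v q over [0, x];
   [f'] solves the same equation, vanishes at L and controls the integral over [x, L]. *)
have P1 : 0 <= v x * f1 x - v1 x * f x - int0 x (fun z => v z * q z).
  have := @green_monotone _ L m v v1 v2 f _ _ q L0 hv hv1
    (prim_hyp L0) (prim_hyp L0) (hyp_cont L0) cq _ f0 vae 0 x (lexx 0) x0 xL'.
  move=> h; apply: (le_trans _ (h _)).
    by rewrite vO int00 fE KO !mulr0 sinh0 /q; lra.
  by move=> z _; rewrite fE KE /hyp /A /q; field.
have P2 : v x * f'1 x - v1 x * f' x - int0 x (fun z => v z * q z) <=
    - int0 L (fun z => v z * q z).
  have := @green_monotone _ L m v v1 v2 f' _ _ q L0 hv hv1
    (prim_hyp L0) (prim_hyp L0) (hyp_cont L0) cq _ f'0 vae x L x0 xL' (lexx L).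
  move=> h; apply: (le_trans (h _) _).
    by move=> z _; rewrite f'E KE /hyp /q sinhB -/s -/c; field.
  by rewrite vL f'L; lra.
(* On subtracting, the common part Z of [f] and [f'] cancels; the hyperbolic terms left over are [X]
   and [Y]. *)
have VQ : int0 L (fun z => v z * q z) <= kap / m * (X + Y).
  have := lerB P1 P2; rewrite sub0r opprK fE f'E /f1 /f'1 /hyp => h.
  apply: (le_trans h); rewrite /X /Y coshB -/s -/c /A.
  by rewrite le_eqVlt; apply/orP; left; apply/eqP; field.
pose k := ((m * L) ^+ 3 / 12 - m * L + 2 * T) / m ^+ 5.
have IKq : integrable_on L (fun z => K z * q z).
  by apply: integrable_onM => //; apply: integrable_on_cont; exact: hyp_cont.
(* m^2 K q is an explicit derivative: K is replaced by (K'' + 1) / m^2, and the product comes from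
   the Wronskian of K and q. *)
have kE : int0 L (fun z => K z * q z) = k.
  have hW := prim_wronskian L0' hK hK1 (@prim_hyp _ m 0 0 0 (L / 2) (- (1 / 2)) 0 0 _ L0)
    (prim_hyp L0) (hyp_cont L0).
  have hS := @prim_hyp _ m 0 0 0 0 (L / 4) (- (1 / 6)) 0 _ L0.
  have h := primB (primB hS (primZ (1 / m ^+ 2) (primD hK1 (prim_id L)))) hW.
  have := primE h LL; rewrite (int0_eq (g := fun z => m ^+ 2 * (K z * q z)) (lexx L)).
    rewrite (int0Z _ (lexx L) IKq) KO KL /K1 /hyp !mulr0 sinh0 cosh0 -/s -/c => e.
    have aux (a1 a2 a3 : R) : a1 = a2 + a3 -> a3 = a1 - a2 by move=> ->; ring.
    by apply: (mulfI (lt0r_neq0 m2)); rewrite (aux _ _ _ e) -Tc /k; field.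
  by move=> z _; rewrite K2E /hyp /q; field.
have k0 : 0 <= k.
  rewrite -kE -(int00 (fun z => K z * q z)); apply: (int0_ge0_ae _ L0' (lexx L)) => //.
  by apply: ae_all => z zL; rewrite mulr_ge0 ?K0 ?q0.
have JE : int0 L (fun z => v z * q z) = J * (1 + N * k).
  have Iw : integrable_on L (fun z => - w2 z * q z).
    have := integrable_onZ (-1) (integrable_onM (integrable_on_cont cw2) cq).
    by congr (integrable_on _ _); apply/funext => z; ring.
  rewrite (int0_eq (g := fun z => - w2 z * q z + N * J * (K z * q z)) (lexx L)).
    rewrite (int0D (lexx L) Iw (integrable_onZ _ IKq)) (int0Z _ (lexx L) IKq) kE.
    by rewrite -(moment_by_parts L0 hw hw1 cw2 w0 wL) -/(I L w) -/J; ring.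
  by move=> z _; rewrite /v; ring.
have XYb : K x * (J * (1 + N * k)) <= kap * T * s / m ^+ 2 * v x.
  rewrite -JE; apply: (le_trans (ler_wpM2l (K0 x xL) VQ)).
  (* The bounds on K are paired crosswise, so that the sum is the combination that [XY] identifies
     with a multiple of v. *)
  have h1 := ler_wpM2r X0 KS'; have h2 := ler_wpM2r Y0 KS.
  have -> : K x * (kap / m * (X + Y)) = kap / m * (K x * X + K x * Y) by ring.
  have km0 : 0 <= kap / m by rewrite divr_ge0// ltW.
  apply: (le_trans (ler_wpM2l km0 (lerD h1 h2))).
  have -> : T / m ^+ 2 * sinh (m * L - m * x) * X + T / m ^+ 2 * sinh (m * x) * Y =
    T / m ^+ 2 * (m * s * v x) by rewrite -XY; ring.
  by rewrite le_eqVlt; apply/orP; left; apply/eqP; field.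
have Nk : N * (kap * T * s / m ^+ 2) <= 1 + N * k.
  have -> : N * (kap * T * s / m ^+ 2) = N * k +
    N * (6 * (m * L) * c + 6 * (m * L) - 12 * s - (m * L) ^+ 3) / (12 * m ^+ 5).
    have -> : kap * T * s = kap * (c - 1) by rewrite -Ts; ring.
    by rewrite -[in X in _ = _ + X]Tc /k /kap; field.
  by rewrite addrC lerD2r ler_pdivrMr ?mul1r// mulr_gt0// exprn_gt0.
have p0 : 0 < 1 + N * k by rewrite ltr_pwDl// mulr_ge0// ltW.
have : 0 <= (1 + N * k) * - w2 x.
  have -> : (1 + N * k) * - w2 x = (1 + N * k) * v x - N * (K x * (J * (1 + N * k))).
    by rewrite /v; ring.
  rewrite subr_ge0; apply: (le_trans (ler_wpM2l (ltW N0) XYb)).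
  by rewrite mulrA; apply: ler_wpM2r.
by rewrite pmulr_rge0// oppr_ge0.
Qed.

Lemma nonlocal_max_principle (L M N : R) (w w1 w2 w3 g : R -> R) :
  0 < L -> 0 < M -> 0 < N ->
  N <= 4 * M / L ^+ 3 * sigma (Num.sqrt M * L) ->
  W41_on L w w1 w2 w3 g -> bc L w w2 ->
  {ae mu, forall x, 0 <= x <= L -> 0 <= g x - M * w2 x + N * I L w} ->
  forall x, 0 <= x <= L -> w2 x <= 0.
Proof.
move=> L0 M0 N0 hN hw hb hae.
pose m := Num.sqrt M; have m0 : 0 < m by rewrite sqrtr_gt0.
have mM : m ^+ 2 = M by rewrite sqr_sqrtr// ltW.
rewrite -mM in hae; apply: (nonlocal_max_principle_aux L0 m0 N0 _ hw hb hae).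
pose D := 6 * (m * L) * cosh (m * L) + 6 * (m * L) - 12 * sinh (m * L) - (m * L) ^+ 3.
move: hN; rewrite -/m /sigma -/D => hN.
(* If D <= 0, the right side of [hN] is nonpositive, also at D = 0, where the quotient is 0 by
   convention. *)
have D0 : 0 < D.
  rewrite ltNge; apply/negP => D0; move: hN; rewrite leNgt => /negP; apply.
  apply: le_lt_trans N0; apply: mulr_ge0_le0.
    by rewrite divr_ge0 ?mulr_ge0 ?exprn_ge0 ?ltW.
  apply: mulr_ge0_le0; last by rewrite invr_le0.
  by rewrite mulr_ge0// exprn_ge0// mulr_ge0// ltW.
rewrite -ler_pdivlMr//; apply: (le_trans hN); rewrite -mM le_eqVlt; apply/orP; left.
by apply/eqP; field; rewrite !gt_eqF.
Qed.

End nonlocal_maximum_principle.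

(** * Linear combinations, pointwise bounds and the barrier *)

Section linear_theory.
Context {R : realType}.
Notation mu := (@lebesgue_measure R).

Lemma C2_lin (L k : R) (w w1 w2 z z1 z2 : R -> R) :
  C2_on L w w1 w2 -> C2_on L z z1 z2 ->
  C2_on L (fun x => w x + k * z x) (fun x => w1 x + k * z1 x)
    (fun x => w2 x + k * z2 x).
Proof.
move=> [cw [hw1 hw]] [cz [hz1 hz]]; split; last first.
  by split; apply: primD => //; exact: primZ.
by move=> x; apply: cvgD; [exact: cw|apply: cvgM; [exact: cvg_cst|exact: cz]].
Qed.

Lemma W41_lin (L k : R) (w w1 w2 w3 g z z1 z2 z3 h : R -> R) :
  W41_on L w w1 w2 w3 g -> W41_on L z z1 z2 z3 h ->
  W41_on L (fun x => w x + k * z x) (fun x => w1 x + k * z1 x)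
    (fun x => w2 x + k * z2 x) (fun x => w3 x + k * z3 x) (fun x => g x + k * h x).
Proof.
move=> [hw [hw2 hw3]] [hz [hz2 hz3]]; split; first exact: C2_lin.
by split; apply: primD => //; exact: primZ.
Qed.

Lemma bc_lin (L k : R) (w w2 z z2 : R -> R) : bc L w w2 -> bc L z z2 ->
  bc L (fun x => w x + k * z x) (fun x => w2 x + k * z2 x).
Proof.
move=> [w0 [wL [w20 w2L]]] [z0 [zL [z20 z2L]]].
by rewrite /bc w0 wL w20 w2L z0 zL z20 z2L !mulr0 !addr0.
Qed.

Lemma C2_integrable (L : R) (w w1 w2 : R -> R) : 0 < L -> C2_on L w w1 w2 ->
  integrable_on L w.
Proof. by move=> L0 [_ [_ h]]; exact: integrable_on_cont (prim_cont (ltW L0) h). Qed.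

Lemma I_lin (L k : R) (w z : R -> R) : integrable_on L w -> integrable_on L z ->
  I L (fun x => w x + k * z x) = I L w + k * I L z.
Proof.
move=> hw hz; rewrite /I (int0D (lexx L) hw (integrable_onZ k hz)).
by rewrite (int0Z _ (lexx L) hz).
Qed.

(** [iter_step] brings its own second derivative of the current iterate; this identifies it with the
    one already estimated. *)
Lemma d2_uniq (L : R) (u u2 u2' : R -> R) : 0 < L -> d2_on L u u2 -> d2_on L u u2' ->
  forall x, 0 <= x <= L -> u2 x = u2' x.
Proof.
move=> L0 [u1 [c [h1 h]]] [u1' [c' [h1' h']]].
have L0' := ltW L0.
have e := prim_uniq L0 h h' (prim_cont L0' h1) (prim_cont L0' h1').
have h1'' := prim_ext (fun x xL => esym (e x xL)) (fun x _ => erefl) L0' h1'.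
exact: (prim_uniq L0 h1 h1'').
Qed.

Lemma I_le (L : R) (w z : R -> R) : 0 <= L -> integrable_on L w -> integrable_on L z ->
  (forall x, 0 <= x <= L -> w x <= z x) -> I L w <= I L z.
Proof.
move=> L0 hw hz wz.
have h : integrable_on L (fun x => z x + -1 * w x).
  by apply: integrable_onD => //; exact: integrable_onZ.
have := int0_ge0_ae (lexx 0) L0 (lexx L) h; rewrite int00 -/(I L _) I_lin// => h1.
have : 0 <= I L z + -1 * I L w; last by lra.
by apply: h1; apply: ae_all => x xL; have := wz x xL; lra.
Qed.

(** w - x w' is nondecreasing from the value 0 and w + (L - x) w' is nonincreasing to the value 0,
    so both are nonnegative; weighted by L - x and x they add up to L w. *)
Lemma C2_concave_ge0 (L : R) (w w1 w2 : R -> R) : 0 < L -> C2_on L w w1 w2 ->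
  w 0 = 0 -> w L = 0 -> (forall x, 0 <= x <= L -> w2 x <= 0) ->
  forall x, 0 <= x <= L -> 0 <= w x.
Proof.
move=> L0 [cw2 [hw1 hw]] w0 wL w20 x /[dup] xL /andP[x0 xL'].
have c1 : {within `[0, L], continuous (fun=> 1 : R)} by move=> z; exact: cvg_cst.
have hx := primM (ltW L0) hw1 (prim_id L) c1.
have hphi := primB hw hx.
have h1 := prim_nondecr hphi _ (lexx 0) x0 xL'.
have hL := primD (primZ L hw1) hphi.
have h2 := prim_nonincr hL _ x0 xL' (lexx L).
have {}h1 : 0 <= w x - w1 x * x.
  have := h1 _; rewrite w0 /= mulr0 subr0; apply.
  apply: ae_all => z /[dup] zL /andP[z0 _].
  by have := mulr_ge0 z0 (_ : 0 <= - w2 z); rewrite oppr_ge0 => /(_ (w20 z zL)); lra.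
have {}h2 : 0 <= L * w1 x + (w x - w1 x * x).
  have := h2 _; rewrite wL /= => hh; apply: le_trans (hh _).
    by lra.
  apply: ae_all => z /[dup] zL /andP[_ zL'].
  have h3 : 0 <= L - z by lra.
  by have := mulr_ge0 h3 (_ : 0 <= - w2 z); rewrite oppr_ge0 => /(_ (w20 z zL)); lra.
have h4 : 0 <= L - x by lra.
rewrite -(pmulr_rge0 _ L0).
by have := addr_ge0 (mulr_ge0 h4 h1) (mulr_ge0 x0 h2); lra.
Qed.

Lemma parabola_C2 (L : R) : 0 < L -> C2_on L (fun x => x * (L - x) / 2)
  (fun x => L / 2 - x) (fun=> -1).
Proof.
move=> L0; have L0' := ltW L0; split; first by move=> z; exact: cvg_cst.
split.
  by apply: prim_ext (@prim_hyp _ 1 0 0 (L / 2) (-1) 0 0 0 L L0) => // x _;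
    rewrite /hyp; ring.
by apply: prim_ext (@prim_hyp _ 1 0 0 0 (L / 2) (- (1 / 2)) 0 0 L L0) => // x _;
    rewrite /hyp; field.
Qed.

Lemma parabola_le (L x : R) : x * (L - x) / 2 <= L ^+ 2 / 8.
Proof. by have := sqr_ge0 (L - 2 * x); lra. Qed.

(** Adding d times the parabola x (L - x) / 2 makes both w and -w concave. *)
Lemma C2_bound (L d : R) (w w1 w2 : R -> R) : 0 < L -> 0 <= d -> C2_on L w w1 w2 ->
  w 0 = 0 -> w L = 0 -> (forall x, 0 <= x <= L -> `|w2 x| <= d) ->
  forall x, 0 <= x <= L -> `|w x| <= d * (L ^+ 2 / 8).
Proof.
move=> L0 d0 hw w0 wL w2d x xL.
have w2b z : 0 <= z <= L -> - d <= w2 z /\ w2 z <= d.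
  by move=> /w2d; rewrite ler_norml => /andP[].
have h1 := C2_concave_ge0 L0 (C2_lin d hw (parabola_C2 L0)).
(* Here w + -2 * w stands for -w. *)
have h2 := C2_concave_ge0 L0 (C2_lin d (C2_lin (-2) hw hw) (parabola_C2 L0)).
have {}h1 : 0 <= w x + d * (x * (L - x) / 2).
  apply: h1 => //; rewrite ?w0 ?wL; first by ring.
    by ring.
  by move=> z /w2b[_]; lra.
have {}h2 : 0 <= (w x + -2 * w x) + d * (x * (L - x) / 2).
  apply: h2 => //; rewrite ?w0 ?wL; first by ring.
    by ring.
  by move=> z /w2b[]; lra.
have := ler_wpM2l d0 (parabola_le L x) => h3.
by rewrite ler_norml; apply/andP; split; lra.
Qed.

Lemma I_bound (L d : R) (w w1 w2 : R -> R) : 0 < L -> 0 <= d -> C2_on L w w1 w2 ->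
  w 0 = 0 -> w L = 0 -> (forall x, 0 <= x <= L -> `|w2 x| <= d) ->
  `|I L w| <= L ^+ 3 / 8 * d.
Proof.
move=> L0 d0 hw w0 wL w2d; have L0' := ltW L0.
have hb := C2_bound L0 d0 hw w0 wL w2d.
have := int0_norm_le (lexx 0) L0' (lexx L) (C2_integrable L0 hw)
  (integrable_on_cst L _) hb.
by rewrite !int00 !subr0 int0_cst// => h; apply: (le_trans h); lra.
Qed.

(** e = x (L^3 - 2 L x^2 + x^3) / 24 is the deflection of a hinged beam under unit load. The
    operator sends it to 1 + M x (L - x) / 2 + N ∫e, at least 1 on [0, L] when M, N >= 0. *)
Lemma barrier (L : R) : 0 < L -> exists e e1 e3,
  [/\ W41_on L e e1 (fun x => - (x * (L - x) / 2)) e3 (fun=> 1),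
      bc L e (fun x => - (x * (L - x) / 2)) & 0 <= I L e].
Proof.
move=> L0; have L0' := ltW L0.
pose e := hyp (1 : R) 0 0 0 (L ^+ 3 / 24) 0 (- (L / 12)) (1 / 24).
pose e1 := hyp (1 : R) 0 0 (L ^+ 3 / 24) 0 (- (L / 4)) (1 / 6) 0.
pose e3 := hyp (1 : R) 0 0 (- (L / 2)) 1 0 0 0.
have h3 : prim_on L e3 (fun=> 1).
  by apply: prim_ext (@prim_hyp _ 1 0 0 (- (L / 2)) 1 0 0 0 L L0) => // x _;
    rewrite /hyp; ring.
have h2 : prim_on L (fun x => - (x * (L - x) / 2)) e3.
  by apply: prim_ext (@prim_hyp _ 1 0 0 0 (- (L / 2)) (1 / 2) 0 0 L L0) => // x _;
    rewrite /e3 /hyp; field.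
have h1 : prim_on L e1 (fun x => - (x * (L - x) / 2)).
  by apply: prim_ext (@prim_hyp _ 1 0 0 (L ^+ 3 / 24) 0 (- (L / 4)) (1 / 6) 0 L L0) => // x _;
    rewrite /e1 /hyp; field.
have h0 : prim_on L e e1.
  apply: prim_ext (@prim_hyp _ 1 0 0 0 (L ^+ 3 / 24) 0 (- (L / 12)) (1 / 24) L L0) => // x _.
  by rewrite /e1 /hyp; field.
have W : W41_on L e e1 (fun x => - (x * (L - x) / 2)) e3 (fun=> 1).
  by split => //; split; [exact: prim_cont h2|].
have B : bc L e (fun x => - (x * (L - x) / 2)).
  by rewrite /bc /e /hyp; do !split; field.
exists e, e1, e3; split => //.
rewrite -[X in X <= _](mul0r L) -int0_cst// -/(I L _).
apply: I_le => //; [exact: integrable_on_cst|exact: C2_integrable L0 W.1|].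
apply: (C2_concave_ge0 L0 W.1); [exact: B.1|exact: B.2.1|].
by move=> x /andP[x0 xL]; rewrite oppr_le0 divr_ge0// mulr_ge0// subr_ge0.
Qed.

(** Abstracted because three cases occur: the given M and N, the local case N = 0, and a + b J in
    place of M. *)
Definition has_max_principle (L M N : R) := forall w w1 w2 w3 g : R -> R,
  W41_on L w w1 w2 w3 g -> bc L w w2 ->
  {ae mu, forall x, 0 <= x <= L -> 0 <= g x - M * w2 x + N * I L w} ->
  forall x, 0 <= x <= L -> w2 x <= 0.

Lemma max_principle_local (L M : R) : 0 < L -> 0 < M -> has_max_principle L M 0.
Proof.
move=> L0 M0 w w1 w2 w3 g [_ [hw2 hw3]] [_ [_ [w20 w2L]]] hae x xL.
pose m := Num.sqrt M; have m0 : 0 < m by rewrite sqrtr_gt0.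
have mM : m ^+ 2 = M by rewrite sqr_sqrtr// ltW.
have := max_principle L0 m0 (primZ (-1) hw2) (primZ (-1) hw3).
rewrite w20 w2L mulr0 => /(_ (lexx _) (lexx _)) h.
have {}h : 0 <= -1 * w2 x; last by lra.
apply: h => //; move: hae; apply: ae_mono => z hz /hz; rewrite mM; lra.
Qed.

(** The principle is applied to w + eta e and -w + eta e with the barrier e; L^2 / 8 is the maximum
    of -e''. *)
Lemma max_principle_bound (L M N eta : R) (w w1 w2 w3 g : R -> R) : 0 < L ->
  0 <= M -> 0 <= N -> 0 <= eta -> has_max_principle L M N ->
  W41_on L w w1 w2 w3 g -> bc L w w2 ->
  {ae mu, forall x, 0 <= x <= L -> `|g x - M * w2 x + N * I L w| <= eta} ->
  forall x, 0 <= x <= L -> `|w2 x| <= eta * (L ^+ 2 / 8).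
Proof.
move=> L0 M0 N0 eta0 mp hw hb hae x xL.
have [e [e1 [e3 [he be e0]]]] := barrier L0.
have Iw := C2_integrable L0 hw.1; have Ie := C2_integrable L0 he.1.
have q0 z : 0 <= z <= L -> 0 <= z * (L - z) / 2.
  by move=> /andP[z0 zL]; rewrite divr_ge0// mulr_ge0// subr_ge0.
have hN := W41_lin (-2) hw hw; have bN := bc_lin (-2) hb hb.
have Ne0 := mulr_ge0 N0 e0.
have h1 := mp _ _ _ _ _ (W41_lin eta hw he) (bc_lin eta hb be) _ x xL.
have h2 := mp _ _ _ _ _ (W41_lin eta hN he) (bc_lin eta bN be) _ x xL.
have {}h1 : w2 x + eta * - (x * (L - x) / 2) <= 0.
  apply: h1; rewrite I_lin//; move: hae; apply: ae_mono => z hz zL.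
  have := hz zL; rewrite ler_norml => /andP[k1 k2].
  have := mulr_ge0 eta0 (addr_ge0 (mulr_ge0 M0 (q0 z zL)) Ne0); lra.
have {}h2 : (w2 x + -2 * w2 x) + eta * - (x * (L - x) / 2) <= 0.
  apply: h2; rewrite I_lin ?I_lin//; last exact: (C2_integrable L0 hN.1).
  move: hae; apply: ae_mono => z hz zL.
  have := hz zL; rewrite ler_norml => /andP[k1 k2].
  have := mulr_ge0 eta0 (addr_ge0 (mulr_ge0 M0 (q0 z zL)) Ne0); lra.
have := ler_wpM2l eta0 (parabola_le L x) => h3.
by rewrite ler_norml; apply/andP; split; lra.
Qed.

(* With [d] a bound for the positive part of [w''], comparison with the barrier
   halves [d]. *)
Lemma max_principle_smaller (L M M' N : R) : 0 < L -> 0 <= M -> 0 <= N ->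
  M' <= M -> M - M' <= 4 / L ^+ 2 ->
  has_max_principle L M N -> has_max_principle L M' N.
Proof.
move=> L0 M0 N0 M'M MM' mp w w1 w2 w3 g hw hb hae.
have [e [e1 [e3 [he be e0]]]] := barrier L0.
have Iw := C2_integrable L0 hw.1; have Ie := C2_integrable L0 he.1.
have d0 : 0 <= M - M' by lra.
have q0 z : 0 <= z <= L -> 0 <= z * (L - z) / 2.
  by move=> /andP[z0 zL]; rewrite divr_ge0// mulr_ge0// subr_ge0.
have half (d : R) : 0 <= d -> (forall x, 0 <= x <= L -> w2 x <= d) ->
    forall x, 0 <= x <= L -> w2 x <= d / 2.
  (* Passing from [M'] to [M] adds -(M - M') w2 >= -k, which k times the barrier compensates; k L^2
     / 8 <= d / 2 because M - M' <= 4 / L^2. *)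
  move=> dd wd x xL; pose k := d * (M - M').
  have k0 : 0 <= k by exact: mulr_ge0.
  have := mp _ _ _ _ _ (W41_lin k hw he) (bc_lin k hb be) _ x xL => h.
  have {}h : w2 x + k * - (x * (L - x) / 2) <= 0.
    apply: h; rewrite I_lin//; move: hae; apply: ae_mono => z hz zL.
    have h1 := hz zL.
    have h2 := mulr_ge0 k0 (addr_ge0 (mulr_ge0 M0 (q0 z zL)) (mulr_ge0 N0 e0)).
    have h3 := mulr_ge0 d0 (_ : 0 <= d - w2 z); rewrite subr_ge0 in h3.
    by have := h3 (wd z zL); rewrite /k in h2 *; lra.
  have h1 := ler_wpM2l k0 (parabola_le L x).
  have h2 : k * (L ^+ 2 / 8) <= d / 2.
    rewrite /k -mulrA; apply: ler_wpM2l => //.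
    have L2 : 0 <= L ^+ 2 / 8 by rewrite divr_ge0// exprn_ge0// ltW.
    apply: (le_trans (ler_wpM2r L2 MM')).
    by rewrite le_eqVlt; apply/orP; left; apply/eqP; field; rewrite gt_eqF.
  by lra.
have [C C0 hC] := cont_bounded hw.1.1.
have pow n : forall x, 0 <= x <= L -> w2 x <= C * 2^-1 ^+ n.
  elim: n => [|n IH] x xL; first by rewrite expr0 mulr1 (le_trans (ler_norm _))// hC.
  have := half _ _ IH x xL; rewrite exprSr mulrA; apply.
  by rewrite mulr_ge0// exprn_ge0// invr_ge0.
move=> x xL; apply/ler_addgt0Pl => eps eps0; rewrite addr0.
have [n /(_ n (leqnn n)) hn] := half_pow_small C0 eps0.
exact: le_trans (pow n x xL) (ltW hn).
Qed.

End linear_theory.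

(** * Existence through a scalar fixed point of the integral *)

Section existence.
Context {R : realType}.
Notation mu := (@lebesgue_measure R).

(** Variation of constants for w2'' - M w2 = f, then two integrations. Integrating [f] once into [P]
    makes the derivatives of [A] and [B] continuous, as [primM] demands; then Y' = m Z + P and Z' =
    m Y. *)
Lemma linear_solution (L M : R) (f : R -> R) : 0 < L -> 0 < M -> integrable_on L f ->
  exists w w1 w2 w3 g, [/\ W41_on L w w1 w2 w3 g, bc L w w2 &
    forall x, g x - M * w2 x = f x].
Proof.
move=> L0 M0 If; have L0' := ltW L0.
pose m := Num.sqrt M; have m0 : 0 < m by rewrite sqrtr_gt0.
have mM : m ^+ 2 = M by rewrite sqr_sqrtr// ltW.
have s0 : 0 < sinh (m * L) by rewrite sinh_gt0// mulr_gt0.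
pose S (x : R) := sinh (m * x); pose C (x : R) := cosh (m * x).
have hS : prim_on L S (fun x => m * C x).
  by apply: prim_ext (@prim_hyp _ m 1 0 0 0 0 0 0 L L0) => // x _; rewrite /hyp /S /C; ring.
have hC : prim_on L C (fun x => m * S x).
  by apply: prim_ext (@prim_hyp _ m 0 1 0 0 0 0 0 L L0) => // x _; rewrite /hyp /S /C; ring.
have CS x : C x ^+ 2 - S x ^+ 2 = 1 by exact: cosh2B_sinh2.
have hP := prim_int0 0 If; set P := (fun x => 0 + int0 x f) in hP.
have cP := prim_cont L0' hP; have cS := prim_cont L0' hS; have cC := prim_cont L0' hC.
have cCP : {within `[0, L], continuous (fun x => C x * P x)}.
  by move=> x; apply: cvgM; [exact: cC|exact: cP].
have cSP : {within `[0, L], continuous (fun x => S x * P x)}.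
  by move=> x; apply: cvgM; [exact: cS|exact: cP].
have hA := prim_int0 0 (integrable_on_cont cCP).
have hB := prim_int0 0 (integrable_on_cont cSP).
set A := (fun x => 0 + int0 x (fun z => C z * P z)) in hA.
set B := (fun x => 0 + int0 x (fun z => S z * P z)) in hB.
pose Y x := C x * A x - S x * B x; pose Z x := S x * A x - C x * B x.
have hY : prim_on L Y (fun x => m * Z x + P x).
  apply: prim_ext (primB (primM L0' hC hA cCP) (primM L0' hS hB cSP)) => // x _.
  by rewrite /Z -[in RHS](mul1r (P x)) -(CS x); ring.
have hZ : prim_on L Z (fun x => m * Y x).
  apply: prim_ext (primB (primM L0' hS hA cCP) (primM L0' hC hB cSP)) => // x _.
  by rewrite /Y; ring.
(* [k] cancels the value of [Y] at L; further down the slope [d] does the same for w. *)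
pose k := Y L / sinh (m * L).
pose w2 x := Y x - k * S x.
pose w3 x := m * Z x + P x - k * (m * C x).
pose g x := f x + M * w2 x.
have h2 : prim_on L w2 w3 by exact: (primB hY (primZ k hS)).
have h3 : prim_on L w3 g.
  apply: prim_ext (primB (primD (primZ m hZ) hP) (primZ k (primZ m hC))) => // x _.
  by rewrite /g /w2 -mM; ring.
have c2 := prim_cont L0' h2.
have I2 := integrable_on_cont c2.
have h1 := prim_int0 0 I2.
have I1 := integrable_on_cont (prim_cont L0' h1).
pose d := - int0 L (fun z => 0 + int0 z w2) / L.
have h1' : prim_on L (fun x => d + (0 + int0 x w2)) w2.
  by apply: prim_ext (primD (prim_cst L d) h1) => // x _; rewrite ?add0r.
have h0 := prim_int0 0 (integrable_on_cont (prim_cont L0' h1')).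
exists (fun x => 0 + int0 x (fun z => d + (0 + int0 z w2))),
  (fun x => d + (0 + int0 x w2)), w2, w3, g; split.
- by split => //; split.
- rewrite /bc int00 add0r; split => //; split.
    rewrite (int0D (lexx L) (integrable_on_cst L d) I1) int0_cst// /d.
    by rewrite divfK ?gt_eqF// add0r addNr.
  rewrite /w2 /Y /A /B /S !mulr0 sinh0 !int00; split; first by ring.
  by rewrite -/(Y L) /k divfK ?gt_eqF// subrr.
- by move=> x; rewrite /g; ring.
Qed.

(** (P) with its integrals frozen at [J]; a solution with I L w = J solves (P). The equation can be
    asked at every x, since the representative [g] of w'''' is free. *)
Definition moment_solution (L a b c : R) (p : R -> R) (J : R) (w : R -> R) :=
  exists w1 w2 w3 g, [/\ W41_on L w w1 w2 w3 g, bc L w w2 &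
    forall x, g x - (a + b * J) * w2 x + c * J = p x].

(** For the coefficient a + b J the difference of the solutions has image (b z'' - c) (J - J0), with
    z'' the second derivative of [w0]. The bound is therefore uniform in J. *)
Lemma moment_solution_lipschitz (L a b c J0 : R) (p w0 : R -> R) :
  0 < L -> 0 <= b -> 0 <= c -> moment_solution L a b c p J0 w0 ->
  exists2 K, 0 <= K & forall J w, 0 < a + b * J -> moment_solution L a b c p J w ->
    `|I L w - I L w0| <= K * `|J - J0|.
Proof.
move=> L0 b0 c0 [z1 [z2 [z3 [h [hz bz ez]]]]].
have [C C0 hC] := cont_bounded hz.1.1.
have bc0 : 0 <= b * C + c by rewrite addr_ge0// mulr_ge0.
exists (L ^+ 3 / 8 * ((b * C + c) * (L ^+ 2 / 8))).
  by rewrite !mulr_ge0// ?exprn_ge0// ?ltW// invr_gt0.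
move=> J w J0' [w1 [w2 [w3 [g [hw bw ew]]]]].
have hd := W41_lin (-1) hw hz; have bd := bc_lin (-1) bw bz.
have eta0 : 0 <= (b * C + c) * `|J - J0| by rewrite mulr_ge0.
have := max_principle_bound L0 (ltW J0') (lexx 0) eta0
  (max_principle_local L0 J0') hd bd _ => hb.
have {}hb x : 0 <= x <= L ->
    `|w2 x + -1 * z2 x| <= (b * C + c) * `|J - J0| * (L ^+ 2 / 8).
  apply: hb; apply: ae_all => y yL.
  have -> : g y + -1 * h y - (a + b * J) * (w2 y + -1 * z2 y) +
      0 * I L (fun x => w x + -1 * w0 x) = (b * z2 y - c) * (J - J0).
    have e1 := ew y; have e2 := ez y.
    have -> : g y = p y + (a + b * J) * w2 y - c * J by rewrite -e1; ring.
    have -> : h y = p y + (a + b * J0) * z2 y - c * J0 by rewrite -e2; ring.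
    by ring.
  rewrite normrM ler_wpM2r//; apply: (le_trans (ler_normB _ _)).
  by rewrite normrM (ger0_norm b0) (ger0_norm c0) lerD2r ler_wpM2l// hC.
have [bd0 [bdL _]] := bd.
have := I_bound L0 _ hd.1 bd0 bdL hb.
rewrite I_lin; [|exact: C2_integrable L0 hw.1|exact: C2_integrable L0 hz.1].
rewrite mulN1r => hh; apply: (le_trans (hh _)).
  by rewrite mulr_ge0// divr_ge0// exprn_ge0// ltW.
by rewrite le_eqVlt; apply/orP; left; apply/eqP; ring.
Qed.

(** Intermediate value theorem for ∫ F J - J, nonnegative at A and nonpositive at B. *)
Lemma moment_fixed_point (L a b c A B : R) (p : R -> R) :
  0 < L -> 0 < a -> 0 < b -> 0 <= c -> 0 <= A -> A <= B -> integrable_on L p ->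
  (forall w, moment_solution L a b c p A w -> A <= I L w) ->
  (forall w, moment_solution L a b c p B w -> I L w <= B) ->
  exists J w, [/\ A <= J, J <= B, moment_solution L a b c p J w & I L w = J].
Proof.
move=> L0 a0 b0 c0 A0 AB Ip hA hB.
have ex J : exists w, 0 < a + b * J -> moment_solution L a b c p J w.
  (* The choice function has to be total; [p] is a dummy value where a + b J is not positive. *)
  have [J0|J0] := ltP 0 (a + b * J); last by exists p.
  have Iq : integrable_on L (fun x => p x + - (c * J)).
    exact: (integrable_onD Ip (integrable_on_cst L _)).
  have [w [w1 [w2 [w3 [g [hw bw e]]]]]] := linear_solution L0 J0 Iq.
  exists w => _; exists w1, w2, w3, g; split => // x.
  by rewrite e; ring.
have [F hF] := choice ex.
have pos J : 0 <= J -> 0 < a + b * J by move=> J0; rewrite ltr_pwDl// mulr_ge0// ltW.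
pose G J := I L (F J) - J.
have cG : {within `[A, B], continuous G}.
  apply: continuous_in_subspaceT => J; rewrite inE/= in_itv/= => /andP[AJ _].
  apply: cvgB; last exact: cvg_id.
  have J0 := le_trans A0 AJ.
  have [K K0 hK] := moment_solution_lipschitz L0 (ltW b0) c0 (hF J (pos J J0)).
  apply/cvgrPdist_lt => e e0; apply/nbhs_ballP.
  have K1 : 0 < K + 1 by rewrite ltr_wpDl.
  (* e / (K + 1) makes the change of the integral small, and a / b keeps a + b z positive. *)
  exists (Num.min (e / (K + 1)) (a / b)); first by rewrite /= lt_min !divr_gt0.
  move=> z; rewrite /ball/= lt_min => /andP[z1 z2].
  have z0 : 0 < a + b * z.
    move: z2; rewrite ltr_pdivlMr// => z2.
    have := ler_wpM2r (ltW b0) (ler_norm (J - z)).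
    by have := mulr_ge0 (ltW b0) J0; lra.
  have := hK z _ z0 (hF z z0); rewrite distrC [`|z - J|]distrC => h.
  apply: (le_lt_trans h); move: z1; rewrite ltr_pdivlMr//.
  have := normr_ge0 (J - z); set k := `|J - z| => k0.
  by lra.
have [J JAB GJ] : exists2 J, J \in `[A, B] & G J = 0.
  apply: IVT => //; rewrite ge_min le_max; apply/andP; split; apply/orP.
    right; rewrite subr_le0; apply: hB; apply: hF; apply: pos; exact: le_trans AB.
  by left; rewrite subr_ge0; apply: hA; apply: hF; exact: pos.
move: JAB; rewrite in_itv/= => /andP[AJ JB].
exists J, (F J); split => //; first by apply: hF; apply: pos; exact: le_trans AJ.
by apply/eqP; rewrite -subr_eq0 -/(G J) GJ.
Qed.

End existence.

(** * The order interval: invariance and contraction *)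

Section order_interval.
Context {R : realType}.
Notation mu := (@lebesgue_measure R).

Lemma comparison (L M N : R) (w w1 w2 w3 g z z1 z2 z3 h : R -> R) : 0 < L ->
  has_max_principle L M N ->
  W41_on L w w1 w2 w3 g -> bc L w w2 -> W41_on L z z1 z2 z3 h -> bc L z z2 ->
  {ae mu, forall x, 0 <= x <= L ->
    0 <= (h x - g x) - M * (z2 x - w2 x) + N * (I L z - I L w)} ->
  forall x, 0 <= x <= L -> w x <= z x /\ z2 x <= w2 x.
Proof.
move=> L0 mp hw bw hz bz hae.
have hd := W41_lin (-1) hz hw; have bd := bc_lin (-1) bz bw.
have := mp _ _ _ _ _ hd bd _ => d2.
have {}d2 x : 0 <= x <= L -> z2 x + -1 * w2 x <= 0.
  apply: d2; rewrite I_lin; [|exact: C2_integrable L0 hz.1|exact: C2_integrable L0 hw.1].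
  by move: hae; apply: ae_mono => y hy /hy; lra.
have [bd0 [bdL _]] := bd.
have d0 := C2_concave_ge0 L0 hd.1 bd0 bdL d2.
by move=> x xL; have := d2 x xL; have := d0 x xL; split; lra.
Qed.

Lemma inf_image_le (L : R) (f : R -> R) : {within `[0, L], continuous f} ->
  forall x, 0 <= x <= L -> inf (f @` `[0, L]) <= f x.
Proof.
move=> cf x xL; have [C _ hC] := cont_bounded cf.
apply: ge_inf; last by exists x => //=; rewrite in_itv.
exists (- C) => _ [y /= + <-]; rewrite in_itv/= => /hC.
by rewrite ler_norml => /andP[].
Qed.

Definition between (L : R) (al al2 be be2 u u2 : R -> R) := forall x, 0 <= x <= L ->
  al x <= u x <= be x /\ be2 x <= u2 x <= al2 x.

(** The image of y' - al is at least (M - (a + b ∫y)) (al'' - y'') + (∫y - ∫al) (N - (c - b al'')),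
    a sum of nonnegative products; be - y' is treated alike. *)
Lemma iteration_between (L a b c M N : R) (p al al2 be be2 y y2 y' w1 w2 w3 g : R -> R) :
  0 < L -> 0 <= b -> has_max_principle L M N ->
  lower_sol L a b c p al al2 -> upper_sol L a b c p be be2 ->
  (forall x, 0 <= x <= L -> c - b * be2 x <= N) ->
  a + b * I L be <= M ->
  d2_on L y y2 -> between L al al2 be be2 y y2 ->
  W41_on L y' w1 w2 w3 g -> bc L y' w2 ->
  {ae mu, forall x, 0 <= x <= L -> g x - M * w2 x + N * I L y' =
     p x + (a + b * I L y) * y2 x - c * I L y - M * y2 x + N * I L y} ->
  between L al al2 be be2 y' w2.
Proof.
move=> L0 b0 mp [a1 [a3 [ga [ha [bca ea]]]]] [b1 [b3 [gb [hb [bcb eb]]]]] hN hM.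
move=> [y1 hy] yb hw bw ew; have L0' := ltW L0.
have Ia := C2_integrable L0 ha.1; have Ib := C2_integrable L0 hb.1.
have Iy := C2_integrable L0 hy.
have ay : I L al <= I L y by apply: I_le => // x /yb[/andP[]].
have yB : I L y <= I L be by apply: I_le => // x /yb[/andP[]].
have Hy : a + b * I L y <= M.
  by apply: le_trans hM; rewrite lerD2l ler_wpM2l.
have lo : forall x, 0 <= x <= L -> al x <= y' x /\ w2 x <= al2 x.
  apply: (comparison L0 mp ha bca hw bw).
  move: ea ew; apply: ae_mono2 => x ea ew xL.
  have := ew xL; have := ea xL; rewrite /Pop; have [_ /andP[k1 k2]] := yb x xL.
  have k3 : 0 <= (M - (a + b * I L y)) * (al2 x - y2 x).
    by rewrite mulr_ge0// subr_ge0.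
  have k4 : 0 <= (I L y - I L al) * (N - (c - b * al2 x)).
    rewrite mulr_ge0// subr_ge0//; apply: le_trans (hN x xL).
    by rewrite lerD2l lerN2 ler_wpM2l// (le_trans k1).
  move: k3 k4; set Ya := I L y; set Aa := I L al; move=> k3 k4 k5 k6.
  by lra.
have hi : forall x, 0 <= x <= L -> y' x <= be x /\ be2 x <= w2 x.
  apply: (comparison L0 mp hw bw hb bcb).
  move: eb ew; apply: ae_mono2 => x eb ew xL.
  have := ew xL; have := eb xL; rewrite /Pop; have [_ /andP[k1 k2]] := yb x xL.
  have k3 : 0 <= (M - (a + b * I L y)) * (y2 x - be2 x).
    by rewrite mulr_ge0// subr_ge0.
  have k4 : 0 <= (I L be - I L y) * (N - (c - b * be2 x)).
    by rewrite mulr_ge0// subr_ge0//; exact: hN.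
  move: k3 k4; set Ya := I L y; set Ba := I L be; move=> k3 k4 k5 k6.
  by lra.
move=> x xL; have [l1 l2] := lo x xL; have [h1 h2] := hi x xL.
by rewrite l1 l2 h1 h2.
Qed.

(** The image of y' - z is (a + b ∫y - M) (y'' - z'') + (N - (c - b z'')) (∫y - ∫z), at most 4 d /
    L^2 in absolute value; [max_principle_bound] multiplies this by L^2 / 8. *)
Lemma iteration_contraction (L a b c M N d : R)
    (p al al2 be be2 y y2 y' w1 w2 w3 g z z1 z2 z3 h : R -> R) :
  0 < L -> 0 <= b -> 0 <= M -> 0 <= d -> c <= N -> 0 <= N -> has_max_principle L M N ->
  integrable_on L al -> integrable_on L be ->
  al 0 = 0 -> be 0 = 0 -> al L = 0 -> be L = 0 ->
  (forall x, 0 <= x <= L -> al2 x <= 0) ->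
  (forall x, 0 <= x <= L -> c - b * be2 x <= N) ->
  a + b * I L be <= M ->
  M - (a + b * I L al) + L ^+ 3 / 4 * (N - c) <= 4 / L ^+ 2 ->
  d2_on L y y2 -> between L al al2 be be2 y y2 ->
  W41_on L y' w1 w2 w3 g -> bc L y' w2 ->
  {ae mu, forall x, 0 <= x <= L -> g x - M * w2 x + N * I L y' =
     p x + (a + b * I L y) * y2 x - c * I L y - M * y2 x + N * I L y} ->
  W41_on L z z1 z2 z3 h -> bc L z z2 -> between L al al2 be be2 z z2 ->
  {ae mu, forall x, 0 <= x <= L -> Pop L a b c z z2 h x = p x} ->
  (forall x, 0 <= x <= L -> `|y2 x - z2 x| <= d) ->
  forall x, 0 <= x <= L -> `|w2 x - z2 x| <= d / 2.
Proof.
move=> L0 b0 M0 d0 cN N0 mp Ia Ib a0 e0 aL eL al20 hN hM hsmall.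
move=> [y1 hy] yb hw bw ew hz bz zb ez hd x xL; have L0' := ltW L0.
have OL : 0 <= (0 : R) <= L by rewrite lexx ltW.
have LL : 0 <= L <= L by rewrite lexx ltW.
have Iy := C2_integrable L0 hy; have Iz := C2_integrable L0 hz.1.
have ay : I L al <= I L y by apply: I_le => // t /yb[/andP[]].
have yB : I L y <= I L be by apply: I_le => // t /yb[/andP[]].
have Hy : a + b * I L y <= M.
  by apply: le_trans hM; rewrite lerD2l ler_wpM2l.
have Hy' : a + b * I L al <= a + b * I L y by rewrite lerD2l ler_wpM2l.
(* [y] inherits zero boundary values from [al] and [be], which [I_bound] needs for y - z. *)
have y0 : y 0 = 0.
  by have [] := yb 0 OL; rewrite a0 e0 => /andP[k1 k2] _; apply/eqP; rewrite eq_le k2 k1.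
have yL : y L = 0.
  by have [] := yb L LL; rewrite aL eL => /andP[k1 k2] _; apply/eqP; rewrite eq_le k2 k1.
have dI : `|I L y - I L z| <= L ^+ 3 / 8 * d.
  have := I_bound L0 d0 (C2_lin (-1) hy hz.1); rewrite I_lin// -[- I L z]mulN1r; apply.
  - by rewrite y0 bz.1; ring.
  - by rewrite yL bz.2.1; ring.
  - by move=> t /hd; rewrite mulN1r.
have hD := W41_lin (-1) hw hz; have bD := bc_lin (-1) bw bz.
pose eta := 4 / L ^+ 2 * d.
have eta0 : 0 <= eta by rewrite mulr_ge0// divr_ge0// exprn_ge0.
have := max_principle_bound L0 M0 N0 eta0 mp hD bD _ xL => hb.
have -> : d / 2 = eta * (L ^+ 2 / 8) by rewrite /eta; field; rewrite gt_eqF.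
rewrite -[- z2 x]mulN1r; apply: hb.
rewrite I_lin//; last exact: C2_integrable L0 hw.1.
move: ew ez; apply: ae_mono2 => t ew ez tL.
have e1 := ew tL; have e2 := ez tL; rewrite /Pop in e2.
have [_ /andP[k1 k2]] := zb t tL.
set Q := (X in `|X|).
have -> : Q = (a + b * I L y - M) * (y2 t - z2 t) +
    (N - (c - b * z2 t)) * (I L y - I L z).
  rewrite /Q; move: e1 e2; set Yw := I L y'; set Yy := I L y; set Yz := I L z.
  by move=> e1 e2; lra.
apply: (le_trans (ler_normD _ _)); rewrite !normrM.
have n1 : `|a + b * I L y - M| <= M - (a + b * I L al).
  by rewrite ler0_norm ?subr_le0//; lra.
have n2 : `|N - (c - b * z2 t)| <= N - c.
  have k3 : b * z2 t <= 0 by rewrite mulr_ge0_le0// (le_trans k2)// al20.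
  have k4 : b * be2 t <= b * z2 t by rewrite ler_wpM2l.
  by have := hN t tL => k5; rewrite ger0_norm; lra.
have m1 := ler_pM (normr_ge0 _) (normr_ge0 _) n1 (hd t tL).
have m2 := ler_pM (normr_ge0 _) (normr_ge0 _) n2 dI.
apply: (le_trans (lerD m1 m2)).
have m3 := ler_wpM2r d0 hsmall.
(* The estimate produces L^3 / 8 where [hsmall] has L^3 / 4; the surplus is nonnegative. *)
have m4 : 0 <= L ^+ 3 / 8 * ((N - c) * d).
  by rewrite mulr_ge0// ?mulr_ge0 ?subr_ge0// exprn_ge0.
by rewrite /eta; lra.
Qed.

End order_interval.

(** * Existence, uniqueness and convergence in the order interval *)

Unset Implicit Arguments.

Theorem theorem4p2 (R : realType) (L a b c M N : R) (p al al2 be be2 : R -> R) :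
  0 < L -> 0 < a -> 0 < b -> 0 < c ->
  integrable_on L p ->
  0 < M -> 0 < N ->
  N <= 4 * M / L ^+ 3 * sigma (Num.sqrt M * L) ->
  lower_sol L a b c p al al2 ->
  upper_sol L a b c p be be2 ->
  (forall x, 0 <= x <= L -> 0 <= al x <= be x /\ be2 x <= al2 x <= 0) ->
  a + b * I L be <= M ->
  c - b * inf (be2 @` `[0, L]) <= N ->
  a + b * I L al + L ^+ 3 / 4 * c > L ^+ 3 * N / 4 + M - 4 / L ^+ 2 ->
  exists yt : R -> R,
    [/\ (exists yt2, Psol L a b c p yt yt2) /\ in_order_interval L al al2 be be2 yt,
        (forall z z2, Psol L a b c p z z2 -> in_order_interval L al al2 be be2 z ->
           forall x, 0 <= x <= L -> z x = yt x),
        (forall y, iteration L a b c M N p al y -> unif_cvg_on L y yt),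
        (forall y, iteration L a b c M N p be y -> unif_cvg_on L y yt) &
        (forall y0, in_order_interval L al al2 be be2 y0 ->
           forall y, iteration L a b c M N p y0 y -> unif_cvg_on L y yt)].
Proof.
move=> L0 a0 b0 c0 Ip M0 N0 hsig lo up ord hM hinf hsmall.
have L0' := ltW L0; have b0' := ltW b0.
have OL : 0 <= (0 : R) <= L by rewrite lexx ltW.
have mp : has_max_principle L M N.
  by move=> w w1 w2 w3 g; exact: nonlocal_max_principle.
have [a1 [a3 [ga [ha [bca ea]]]]] := lo.
have [b1 [b3 [gb [hb [bcb eb]]]]] := up.
have [al0 [alL [al20 al2L]]] := bca; have [be0 [beL [be20 be2L]]] := bcb.
have Ia := C2_integrable L0 ha.1; have Ib := C2_integrable L0 hb.1.
have hN x : 0 <= x <= L -> c - b * be2 x <= N.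
  move=> xL; apply: le_trans hinf; rewrite lerD2l lerN2 ler_wpM2l//.
  exact: (inf_image_le hb.1.1).
(* At 0 the boundary value be'' = 0 reduces the bound to c <= N. *)
have cN : c <= N by have := hN 0 OL; rewrite be20; lra.
have {}hsmall : M - (a + b * I L al) + L ^+ 3 / 4 * (N - c) <= 4 / L ^+ 2 by lra.
have al2_le0 x : 0 <= x <= L -> al2 x <= 0 by move=> /ord[_ /andP[]].
have hN' x : 0 <= x <= L -> c - b * al2 x <= N.
  move=> xL; apply: le_trans (hN x xL); rewrite lerD2l lerN2 ler_wpM2l//.
  by have [_ /andP[]] := ord x xL.
have A0 : 0 <= I L al.
  rewrite -[X in X <= _](mul0r L) -int0_cst// -/(I L _).
  by apply: I_le => //; [exact: integrable_on_cst|move=> x /ord[/andP[]]].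
have AB : I L al <= I L be by apply: I_le => // x /ord[/andP[]].
have pos J : I L al <= J -> 0 < a + b * J.
  by move=> AJ; rewrite ltr_pwDl// mulr_ge0// (le_trans A0).
(* [al] is a lower solution of the problem frozen at its own integral, so the local comparison
   applies; [hB] is the counterpart for [be]. *)
have hA w : moment_solution L a b c p (I L al) w -> I L al <= I L w.
  move=> [w1 [w2 [w3 [g [hw bw ew]]]]].
  apply: I_le => //; first exact: C2_integrable L0 hw.1.
  move=> x xL.
  have := comparison L0 (max_principle_local L0 (pos _ (lexx _))) ha bca hw bw _ xL.
  case=> //; move: ea; apply: ae_mono => t ea tL; have := ea tL; rewrite /Pop.
  by have := ew t; set k := a + b * _; lra.
have hB w : moment_solution L a b c p (I L be) w -> I L w <= I L be.
  move=> [w1 [w2 [w3 [g [hw bw ew]]]]].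
  apply: I_le => //; first exact: C2_integrable L0 hw.1.
  move=> x xL.
  have := comparison L0 (max_principle_local L0 (pos _ AB)) hw bw hb bcb _ xL.
  case=> //; move: eb; apply: ae_mono => t eb tL; have := eb tL; rewrite /Pop.
  by have := ew t; set k := a + b * _; lra.
have [J [w [AJ JB [w1 [w2 [w3 [g [hw bw ew]]]]] IJ]]] :=
  moment_fixed_point L0 a0 b0 (ltW c0) A0 AB Ip hA hB.
(* M - (a + b J) <= M - (a + b ∫al), which [hsmall] and c <= N bound by 4 / L^2. *)
have mpJ : has_max_principle L (a + b * J) N.
  have J1 := ler_wpM2l b0' AJ; have J2 := ler_wpM2l b0' JB.
  apply: (max_principle_smaller L0 (ltW M0) (ltW N0) _ _ mp); first by lra.
  have : 0 <= L ^+ 3 / 4 * (N - c).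
    by rewrite mulr_ge0 ?subr_ge0// divr_ge0// exprn_ge0.
  by lra.
(* With coefficient a + b J the images of w - al and be - w are at least (J - ∫al) (N - (c - b
   al'')) and (∫be - J) (N - (c - b be'')). *)
have wbet : between L al al2 be be2 w w2.
  have lo1 : forall x, 0 <= x <= L -> al x <= w x /\ w2 x <= al2 x.
    apply: (comparison L0 mpJ ha bca hw bw); rewrite IJ.
    move: ea; apply: ae_mono => t ea tL; have := ea tL; have := ew t; rewrite /Pop.
    have : 0 <= (J - I L al) * (N - (c - b * al2 t)).
      by rewrite mulr_ge0// subr_ge0//; exact: hN'.
    by set A := I L al; lra.
  have hi1 : forall x, 0 <= x <= L -> w x <= be x /\ be2 x <= w2 x.
    apply: (comparison L0 mpJ hw bw hb bcb); rewrite IJ.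
    move: eb; apply: ae_mono => t eb tL; have := eb tL; have := ew t; rewrite /Pop.
    have : 0 <= (I L be - J) * (N - (c - b * be2 t)).
      by rewrite mulr_ge0// subr_ge0//; exact: hN.
    by set B := I L be; lra.
  move=> x xL; have [l1 l2] := lo1 x xL; have [h1 h2] := hi1 x xL.
  by rewrite l1 l2 h1 h2.
have eP : {ae (@lebesgue_measure R), forall x, 0 <= x <= L -> Pop L a b c w w2 g x = p x}.
  by apply: ae_all => x _; rewrite /Pop IJ.
have [D D0 hD] := cont_bounded hb.1.1.
have cvg y0 : in_order_interval L al al2 be be2 y0 ->
    forall y, iteration L a b c M N p y0 y -> unif_cvg_on L y w.
  move=> [u2 [du ub]] y [y0E step].
  have P n : exists v2, [/\ d2_on L (y n) v2, between L al al2 be be2 (y n) v2 &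
      forall x, 0 <= x <= L -> `|v2 x - w2 x| <= D * 2^-1 ^+ n].
    elim: n => [|n [v2 [dv vb vd]]].
      (* Both second derivatives lie between be'' and al'' <= 0, so they differ by at most [D]. *)
      exists u2; rewrite y0E; split => // x xL; rewrite expr0 mulr1.
      have [_ /andP[k1 k2]] := ub x xL; have [_ /andP[k3 k4]] := wbet x xL.
      have k5 := al2_le0 x xL; have := hD x xL; rewrite !ler_norml => /andP[k6 k7].
      by apply/andP; split; lra.
    have [y2 [dy [z1 [z2 [z3 [h [hz [bz ez]]]]]]]] := step n.
    have y2E := d2_uniq L0 dy dv.
    have yb : between L al al2 be be2 (y n) y2 by move=> x xL; rewrite y2E//; exact: vb.
    exists z2; split; first by exists z1; exact: hz.1.
      exact: (iteration_between L0 b0' mp lo up hN hM dy yb hz bz ez).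
    move=> x xL; rewrite exprSr mulrA.
    apply: (iteration_contraction L0 b0' (ltW M0) _ cN (ltW N0) mp Ia Ib al0 be0 alL beL
      al2_le0 hN hM hsmall dy yb hz bz ez hw bw wbet eP) => //.
      by rewrite mulr_ge0// exprn_ge0// invr_ge0.
    by move=> t tL; rewrite y2E//; exact: vd.
  move=> e e0.
  have L2 : 0 <= L ^+ 2 / 8 by rewrite divr_ge0// exprn_ge0.
  have [n0 hn0] := half_pow_small (mulr_ge0 D0 L2) e0.
  exists n0 => n /hn0 hn x xL; apply: le_lt_trans hn.
  have [v2 [[v1 hv] vb vd]] := P n.
  have d0 : 0 <= D * 2^-1 ^+ n by rewrite mulr_ge0// exprn_ge0// invr_ge0.
  have LL : 0 <= L <= L by rewrite lexx ltW.
  have := C2_bound L0 d0 (C2_lin (-1) hv hw.1) _ _ _ xL => h; rewrite -[- w x]mulN1r.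
  apply: (le_trans (h _ _ _)).
  - have [] := vb 0 OL; rewrite al0 be0 => /andP[k1 k2] _; rewrite bw.1.
    by apply/eqP; rewrite mulr0 addr0 eq_le k2 k1.
  - have [] := vb L LL; rewrite alL beL => /andP[k1 k2] _; rewrite bw.2.1.
    by apply/eqP; rewrite mulr0 addr0 eq_le k2 k1.
  - by move=> t tL; rewrite mulN1r; exact: vd.
  by rewrite le_eqVlt; apply/orP; left; apply/eqP; ring.
exists w; split.
- split; first by exists w2, w1, w3, g.
  by exists w2; split; [exists w1; exact: hw.1|exact: wbet].
- move=> z z2 [z1 [z3 [h [hz [bz ez]]]]] zi x xL.
  have it : iteration L a b c M N p z (fun=> z).
    split => // n; exists z2; split; first by exists z1; exact: hz.1.
    exists z1, z2, z3, h; do 2!split => //.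
    (* When both iterates are z, the terms with [M] and [N] cancel and (P) remains. *)
    by move: ez; apply: ae_mono => t ez tL; rewrite -(ez tL) /Pop; ring.
  apply/eqP; rewrite -subr_eq0 -normr_le0; apply/ler_addgt0Pl => e e0; rewrite addr0.
  have [n hn] := cvg z zi _ it e e0.
  by apply/ltW; exact: (hn n (leqnn n) x xL).
- apply: cvg; exists al2; split; first by exists a1; exact: ha.1.
  by move=> x xL; have [/andP[h1 h2] /andP[h3 h4]] := ord x xL; rewrite !lexx h2 h3.
- apply: cvg; exists be2; split; first by exists b1; exact: hb.1.
  by move=> x xL; have [/andP[h1 h2] /andP[h3 h4]] := ord x xL; rewrite !lexx h2 h3.
- exact: cvg.
Qed.
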